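(* Let $\mathcal{T}_n$ denote the set of topological equivalence classes of generic two-layer 3D mosaic floor plans with $n$ blocks. Then \[ \log |\mathcal{T}_n| \geq \left(\frac{1}{3}-o(1)\right)n \log n . \]
   Context: A 3D mosaic floor plan with $n$ blocks is a partition of an axis-parallel box $H=[0,a]\times[0,b]\times[0,c]$ (the host box) into $n$ axis-parallel boxes (the blocks) with pairwise disjoint interiors. It is two-layer if there is $0<h<c$ such that the $z$-extent of every block is $[0,h]$, $[h,c]$ or $[0,c]$. A corner is a point that is a vertex of at least one block; a corner is generic if the combinatorial shape of the local arrangement of the blocks around it is stable under every sufficiently small perturbation of the blocks adjacent to it (the perturbation is local and need not extend to the whole floor plan); a floor plan is generic if all its corners are generic. Two faces of blocks are attached if their intersection has positive area; a dissection plane is the union of the faces in one class of the equivalence relation generated by attachment. For each coordinate direction, the dissection graph is the directed multigraph whose vertices are the dissection planes orthogonal to that direction, with one edge per block joining the two dissection planes containing the block's two faces orthogonal to that direction, oriented towards the larger coordinate. Two floor plans are topologically equivalent if for each of the three directions their dissection graphs are isomorphic. *)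

(* Defs.v *)
From mathcomp Require Import all_boot all_order all_algebra.
From mathcomp Require Import finmap.
From mathcomp Require Import all_classical all_reals all_analysis.

Set Implicit Arguments.
Unset Strict Implicit.
Unset Printing Implicit Defensive.

Import Order.TTheory GRing.Theory Num.Theory.
Import numFieldNormedType.Exports.

Local Open Scope classical_set_scope.
Local Open Scope ring_scope.

(* Coordinate directions are indexed by 'I_3; the vertical one is the last. *)
Definition zdir : 'I_3 := ord_max.

Definition point3 (R : realType) := 'I_3 -> R.

Record box (R : realType) := Box { lo : point3 R; hi : point3 R }.

Definition nondegenerate (R : realType) (B : box R) : Prop :=
  forall d, lo B d < hi B d.

Definition box_set (R : realType) (B : box R) : set (point3 R) :=
  [set p | forall d, lo B d <= p d <= hi B d].

Definition box_interior (R : realType) (B : box R) : set (point3 R) :=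
  [set p | forall d, lo B d < p d < hi B d].

(* The labelling of the blocks by 'I_n carries no information: the notion of
   equivalence below is invariant under relabelling. *)
Record floorplan (R : realType) (n : nat) := Floorplan {
  host : box R;
  block : 'I_n -> box R;
  host_origin : forall d, lo host d = 0;
  host_nondegenerate : nondegenerate host;
  block_nondegenerate : forall i, nondegenerate (block i);
  block_cover : \bigcup_i box_set (block i) = box_set host;
  block_disjoint : forall i j, i != j ->
    box_interior (block i) `&` box_interior (block j) = set0
}.

Definition two_layer (R : realType) (n : nat) (F : floorplan R n) : Prop :=
  exists h : R, 0 < h < hi (host F) zdir /\
    forall i, let z := (lo (block F i) zdir, hi (block F i) zdir) in
      [\/ z = (0, h), z = (h, hi (host F) zdir) | z = (0, hi (host F) zdir)].

Definition box_vertex (R : realType) (B : box R) (p : point3 R) : Prop :=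
  forall d, p d = lo B d \/ p d = hi B d.

Definition corner (R : realType) (n : nat) (F : floorplan R n) (p : point3 R) :
  Prop := exists i, box_vertex (block F i) p.

Definition adjacent (R : realType) (n : nat) (F : floorplan R n) (p : point3 R)
  (i : 'I_n) : Prop := box_set (block F i) p.

(* An octant is a choice of sign in each direction. [occupies B p s] says that
   the part of the octant s at p that is close to p lies in B, i.e. that
   p + t s is in the interior of B for all small t > 0. *)
Definition octant := 'I_3 -> bool.

Definition occupies (R : realType) (B : box R) (p : point3 R) (s : octant) :
  Prop :=
  forall d, if s d then lo B d <= p d < hi B d else lo B d < p d <= hi B d.

(* B' moves every coordinate of every block adjacent to p by less than e, in
   such a way that the moved blocks have pairwise disjoint interiors and still
   fill the part of the host box at distance less than r from p. The blocks
   not adjacent to p play no role. *)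
Definition local_perturbation (R : realType) (n : nat) (F : floorplan R n)
  (p : point3 R) (r e : R) (B' : 'I_n -> box R) : Prop :=
  [/\ forall i, adjacent F p i -> forall d,
        `|lo (B' i) d - lo (block F i) d| < e /\
        `|hi (B' i) d - hi (block F i) d| < e,
      forall i j, adjacent F p i -> adjacent F p j -> i != j ->
        box_interior (B' i) `&` box_interior (B' j) = set0 &
      forall q : point3 R, (forall d, `|q d - p d| < r) ->
        (box_set (host F) q <->
         exists i, adjacent F p i /\ box_set (B' i) q)].

(* The combinatorial shape of the arrangement at a point is the assignment, to
   each of the 8 octants, of the block occupying it (none outside the host). *)
Definition same_shape (R : realType) (n : nat) (F : floorplan R n)
  (p : point3 R) (B' : 'I_n -> box R) (p' : point3 R) : Prop :=
  forall i, adjacent F p i -> forall s : octant,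
    occupies (block F i) p s <-> occupies (B' i) p' s.

(* Perturbations of size less than e are considered on the r-neighbourhood of p;
   the condition gets stronger as r decreases, so that it is about arbitrarily
   small r, for which the r-neighbourhood meets only blocks adjacent to p. *)
Definition generic_corner (R : realType) (n : nat) (F : floorplan R n)
  (p : point3 R) : Prop :=
  forall r : R, 0 < r -> exists e : R, 0 < e /\
    forall B' : 'I_n -> box R, local_perturbation F p r e B' ->
      exists p' : point3 R, same_shape F p B' p'.

Definition generic (R : realType) (n : nat) (F : floorplan R n) : Prop :=
  forall p, corner F p -> generic_corner F p.

(* The faces orthogonal to a given direction: (i, false) is the lower face of
   the block i and (i, true) its upper face. *)
Definition face (n : nat) := ('I_n * bool)%type.

Definition face_coord (R : realType) (n : nat) (F : floorplan R n) (d : 'I_3)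
  (f : face n) : R :=
  if f.2 then hi (block F f.1) d else lo (block F f.1) d.

Definition overlap_area (R : realType) (n : nat) (F : floorplan R n)
  (d : 'I_3) (f g : face n) : R :=
  if face_coord F d f == face_coord F d g then
    \prod_(k < 3 | k != d)
      Num.max 0 (Num.min (hi (block F f.1) k) (hi (block F g.1) k)
                 - Num.max (lo (block F f.1) k) (lo (block F g.1) k))
  else 0.

(* Faces orthogonal to different directions meet in a null set, so that only
   faces orthogonal to the same direction can be attached. *)
Definition attached (R : realType) (n : nat) (F : floorplan R n) (d : 'I_3) :
  rel (face n) := [rel f g | 0 < overlap_area F d f g].

(* As [attached] is symmetric, [connect] gives the generated equivalence. *)
Definition plane_of (R : realType) (n : nat) (F : floorplan R n) (d : 'I_3)
  (f : face n) : {set face n} := [set g | connect (attached F d) f g]%SET.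

(* A dissection plane is represented by its class of faces; two distinct
   classes have unions that overlap in a null set, hence are distinct. *)
Definition dissection_plane (R : realType) (n : nat) (F : floorplan R n)
  (d : 'I_3) := {P : {set face n} | [exists f, P == plane_of F d f]}.

Lemma plane_ofP (R : realType) (n : nat) (F : floorplan R n) (d : 'I_3)
  (f : face n) : [exists g, plane_of F d f == plane_of F d g].
Proof. by apply/existsP; exists f. Qed.

Definition plane (R : realType) (n : nat) (F : floorplan R n) (d : 'I_3)
  (f : face n) : dissection_plane F d :=
  exist _ (plane_of F d f) (plane_ofP F d f).

Record multidigraph := Multidigraph {
  vertex : Type;
  edge : Type;
  source : edge -> vertex;
  target : edge -> vertex
}.

Definition isomorphic (G H : multidigraph) : Prop :=
  exists (phi : vertex G -> vertex H) (psi : edge G -> edge H),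
    [/\ bijective phi, bijective psi,
        forall a, source (psi a) = phi (source a) &
        forall a, target (psi a) = phi (target a)].

Definition dissection_graph (R : realType) (n : nat) (F : floorplan R n)
  (d : 'I_3) : multidigraph :=
  @Multidigraph (dissection_plane F d) 'I_n
    (fun i => plane F d (i, false)) (fun i => plane F d (i, true)).

Definition topologically_equivalent (R : realType) (n : nat)
  (F G : floorplan R n) : Prop :=
  forall d, isomorphic (dissection_graph F d) (dissection_graph G d).

Definition generic_two_layer (R : realType) (n : nat) :
  set (floorplan R n) := [set F | two_layer F /\ generic F].

Definition equivalence_class (R : realType) (n : nat) (F : floorplan R n) :
  set (floorplan R n) :=
  [set G | generic_two_layer G /\ topologically_equivalent F G].

Definition T_classes (R : realType) (n : nat) : set (set (floorplan R n)) :=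
  [set equivalence_class F | F in @generic_two_layer R n].

(* [fset_set] sends an infinite set to the empty one; T_classes is finite since
   a dissection graph has n edges and no isolated vertex. *)
Definition card_T (R : realType) (n : nat) : nat :=
  #|` fset_set (@T_classes R n)|%fset.

(* Main.v *)
(**
Put full-height unit pillars on a rectangular grid, at points with odd
coordinates, and fill the rest of the bottom layer with unit-wide columns and
the rest of the top layer with unit-wide rows, both cut by the pillars. As the
even columns and rows are uncut, no two pillars touch and around every corner
all the walls orthogonal to a given direction are glued together, so that they
move together in a perturbation and the floor plan is generic. With k pillars
there are 3 k blocks, up to the numbers of columns and rows.

In the dissection graph of the x-direction, the bottom layer provides a directed
path through all the coordinates, which pins down the coordinate of every
interior plane. The graph hence determines the pairs (x, x') such that x and x'
are the abscissae of consecutive pillars of a row.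

Take m + 1 groups of columns and m * m * P rows indexed by (i, k, a), each with
one pillar per group. In an even group the rows with first index i use P columns
of their own, in an odd group those with second index k do, and within these P
columns the row (i, k, a) uses the a-th one up to a permutation depending on the
group, i and k. Going from group to group, the pairs (x, x') reveal i, k and the
permutations. This gives (P!) ^ (m ^ 3) classes with (3 + O(1 / m)) m ^ 3 P
blocks. *)

From mathcomp Require Import all_boot all_order all_algebra.
From mathcomp Require Import perm.
From mathcomp Require Import all_classical all_reals all_analysis.
From mathcomp Require Import zify ring lra.
Require Import Defs.
Set Implicit Arguments.
Unset Strict Implicit.
Unset Printing Implicit Defensive.
Import Order.TTheory GRing.Theory Num.Theory.
Import numFieldNormedType.Exports.
Local Open Scope classical_set_scope.
Local Open Scope ring_scope.

(** * Rigid walls and generic corners *)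

Definition orient (s : octant) (d : 'I_3) (b : bool) : octant :=
  fun k => if k == d then b else s k.

Lemma orient_eq s d b : orient s d b d = b.
Proof. by rewrite /orient eqxx. Qed.

Lemma orient_neq s d b k : k != d -> orient s d b k = s k.
Proof. by rewrite /orient => /negbTE ->. Qed.

Lemma orient_id s d : orient s d (s d) = s.
Proof. by apply/funext => k; rewrite /orient; case: eqP => [->|]. Qed.

Lemma orient_orient s d b b' : orient (orient s d b) d b' = orient s d b'.
Proof. by apply/funext => k; rewrite /orient; case: eqP. Qed.

Section Rigidity.
Context {I V : Type} (occupant : I -> octant -> Prop) (d : 'I_3).

Definition wall (s : octant) (i j : I) : Prop :=
  [/\ occupant i (orient s d false), occupant j (orient s d true) & i <> j].

(* Here u and v stand for the moved coordinates of the upper and of the lower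
   faces of the blocks: all the walls must move together as soon as the two
   blocks of each wall stay in contact. *)
Definition rigid : Prop := forall u v : I -> V,
  (forall s i j, wall s i j -> u i = v j) ->
  forall s s' i i' j j', wall s i j -> wall s' i' j' -> u i = u i'.

End Rigidity.

Section Clearance.
Context {R : realType}.
Implicit Types (e x v t : R) (B : box R) (p : point3 R) (s : octant).

Definition clear_of e x v : Prop :=
  [\/ v + 3 * e <= x, v = x | x + 3 * e <= v].

Lemma near_clear_of x v : \forall e \near 0^'+, clear_of e x v.
Proof.
have small y : 0 < y -> \forall e \near 0^'+, 3 * e <= y.
  move=> y_gt0; near do rewrite mulrC -ler_pdivlMr //.
  by apply: nbhs_right_le; rewrite divr_gt0.
case: (ltgtP v x) => [vx|xv|->]; last by apply: nearW => e; constructor 2.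
- near=> e; constructor 1; rewrite -lerBrDl; near: e.
  by apply: small; rewrite subr_gt0.
- near=> e; constructor 3; rewrite -lerBrDl; near: e.
  by apply: small; rewrite subr_gt0.
Unshelve. all: by end_near. Qed.

Definition box_clear e p B : Prop :=
  forall d, clear_of e (p d) (lo B d) /\ clear_of e (p d) (hi B d).

Lemma near_box_clear p B : \forall e \near 0^'+, box_clear e p B.
Proof. by apply: filter_forall => d; near do split; apply: near_clear_of.
Unshelve. all: by end_near. Qed.

Definition bound (b : bool) B : point3 R := if b then hi B else lo B.

Definition octant_point p s t : point3 R :=
  fun k => if s k then p k + t else p k - t.

Lemma occupies_interior e t B p s : box_clear e p B -> 0 < t < 3 * e ->
  occupies B p s -> box_interior B (octant_point p s t).
Proof.
move=> clearB /andP[t_gt0 t_lt] occ k; have := occ k; rewrite /octant_point.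
have [cl ch] := clearB k; case: (s k) => /= /andP[lp ph]; apply/andP; split;
  by case: cl; case: ch; lra.
Qed.

Lemma octant_point_occupies e t B p s : box_clear e p B -> 0 < t < 3 * e ->
  box_set B (octant_point p s t) -> occupies B p s.
Proof.
move=> clearB /andP[t_gt0 t_lt] inB k; have := inB k; rewrite /octant_point.
have [cl ch] := clearB k; case: (s k) => /= /andP[lp ph]; apply/andP; split;
  by case: cl; case: ch; lra.
Qed.

Lemma box_interior_sub B : box_interior B `<=` box_set B.
Proof. by move=> q inB k; have /andP[/ltW -> /ltW ->] := inB k. Qed.

Lemma occupies_box_set B p s : occupies B p s -> box_set B p.
Proof. by move=> occ k; have := occ k; case: (s k) => /andP[? ?]; lra. Qed.

Lemma box_set_occupies B p : nondegenerate B -> box_set B p ->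
  exists s, occupies B p s.
Proof.
move=> ndB inB; exists (fun k => p k < hi B k) => k.
have := ndB k; have /andP[-> ->] := inB k; case: (ltP (p k)) => //= hi_le lo_hi.
by rewrite andbT (lt_le_trans lo_hi hi_le).
Qed.

Lemma occupies_bound B p s d b :
  occupies B p s -> bound b B d = p d -> s d = ~~ b.
Proof.
move=> occ pE; have := occ d.
by case: b pE => /= ->; rewrite ltxx ?andbF; case: (s d).
Qed.

Lemma occupies_orient B p s d b :
  occupies B p s -> bound b B d <> p d -> occupies B p (orient s d b).
Proof.
move=> occ /eqP pN k; have := occ k; rewrite /orient; case: eqP => // ->.
have /andP[lo_p p_hi] := occupies_box_set occ d.
case: b pN => /= pN _; first by rewrite lo_p lt_neqAle eq_sym pN.
by rewrite p_hi lt_neqAle pN lo_p.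
Qed.

End Clearance.

Section Octants.
Context {R : realType} {n : nat} (F : floorplan R n) (p : point3 R).
Implicit Types (s : octant) (i j : 'I_n) (d : 'I_3).

Lemma near_blocks_clear :
  \forall e \near 0^'+, forall i, box_clear e p (block F i).
Proof. by apply: filter_forall => i; apply: near_box_clear. Qed.

Lemma block_sub_host i : box_set (block F i) `<=` box_set (host F).
Proof. by rewrite -(block_cover F) => q qi; exists i. Qed.

Lemma occupant_unique s i j :
  occupies (block F i) p s -> occupies (block F j) p s -> i = j.
Proof.
move=> occ_i occ_j; apply/eqP/negPn/negP => ij; near (0 : R)^'+ => e.
have e3 : 0 < e < 3 * e by rewrite ltr_pMl // ltr1n andbT.
have clearF k : box_clear e p (block F k).
  by move: k; near: e; exact: near_blocks_clear.
have := block_disjoint F ij; rewrite -subset0; apply; split.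
  exact: occupies_interior (clearF i) e3 occ_i.
exact: occupies_interior (clearF j) e3 occ_j.
Unshelve. all: by end_near. Qed.

Lemma occupant_exists s :
  occupies (host F) p s -> exists i, occupies (block F i) p s.
Proof.
move=> occ; near (0 : R)^'+ => e.
have e3 : 0 < e < 3 * e by rewrite ltr_pMl // ltr1n andbT.
have : box_set (host F) (octant_point p s e).
  apply: box_interior_sub; apply: occupies_interior e3 occ.
  by near: e; exact: near_box_clear.
rewrite -(block_cover F) => -[i _ inBi]; exists i.
apply: octant_point_occupies e3 inBi.
by move: i; near: e; exact: near_blocks_clear.
Unshelve. all: by end_near. Qed.

Lemma occupies_host s i : occupies (block F i) p s -> occupies (host F) p s.
Proof.
move=> occ; near (0 : R)^'+ => e.
have e3 : 0 < e < 3 * e by rewrite ltr_pMl // ltr1n andbT.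
apply: (octant_point_occupies _ e3); first by near: e; exact: near_box_clear.
apply/(@block_sub_host i)/box_interior_sub; apply: occupies_interior e3 occ.
by near: e; exact: near_box_clear.
Unshelve. all: by end_near. Qed.

Definition block_occupies i s : Prop := occupies (block F i) p s.

Definition wall_at d := wall block_occupies d.

Lemma wall_faces d s i j :
  wall_at d s i j -> hi (block F i) d = p d /\ lo (block F j) d = p d.
Proof.
move=> [occ_i occ_j ij]; split; apply/eqP/negPn/negP => /eqP faceN; apply: ij.
  have := occupies_orient (b := true) occ_i faceN.
  rewrite orient_orient => occ_i'.
  exact: occupant_unique occ_i' occ_j.
have := occupies_orient (b := false) occ_j faceN.
rewrite orient_orient => occ_j'.
exact: occupant_unique occ_i occ_j'.
Qed.

Lemma wall_inside_host d s i j b : wall_at d s i j -> bound b (host F) d <> p d.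
Proof.
move=> [/occupies_host occ_i /occupies_host occ_j _] b_host.
have := occupies_bound occ_i b_host; rewrite orient_eq.
by have := occupies_bound occ_j b_host; rewrite orient_eq => <-.
Qed.

Lemma face_inside_host d i b : adjacent F p i -> bound b (block F i) d = p d ->
  bound b (host F) d <> p d ->
  exists s j, if b then wall_at d s i j else wall_at d s j i.
Proof.
move=> adj b_i b_host.
have [s occ] := box_set_occupies (block_nondegenerate F i) adj.
have sd : s d = ~~ b := occupies_bound occ b_i.
have [j occ_j] := occupant_exists (occupies_orient (occupies_host occ) b_host).
have ij : i <> j.
  move=> ij; rewrite -ij in occ_j; have := occupies_bound occ_j b_i.
  by rewrite orient_eq; case: (b).
exists s, j; rewrite -(orient_id s d) sd in occ.
by case: b occ_j occ {b_i b_host sd} => /= occ_j occ; split=> //; exact: nesym.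
Qed.

End Octants.

Section Perturbation.
Context {R : realType} {n : nat} (F : floorplan R n) (p : point3 R).
Context (e r : R) (B' : 'I_n -> box R).
Hypothesis e_gt0 : 0 < e.
Hypothesis e_r : 2 * e < r.
Hypothesis p_host : box_set (host F) p.
Hypothesis blocks_clear : forall i, box_clear e p (block F i).
Hypothesis moved : local_perturbation F p r e B'.
Implicit Types (s : octant) (i j : 'I_n) (d k : 'I_3) (x : R).

Lemma moved_lo i d : adjacent F p i ->
  lo (block F i) d - e < lo (B' i) d < lo (block F i) d + e.
Proof. by case: moved => near_i _ _ /near_i/(_ d)[+ _]; rewrite ltr_distl. Qed.

Lemma moved_hi i d : adjacent F p i ->
  hi (block F i) d - e < hi (B' i) d < hi (block F i) d + e.
Proof. by case: moved => near_i _ _ /near_i/(_ d)[_]; rewrite ltr_distl. Qed.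

Lemma moved_lo_lt i d : adjacent F p i -> lo (block F i) d < p d ->
  lo (B' i) d < p d - 2 * e.
Proof.
move=> adj; have /andP[_ ?] := moved_lo d adj; move: e_gt0 => ?.
by have [[?|?|?] _] := blocks_clear i d; lra.
Qed.

Lemma moved_hi_gt i d : adjacent F p i -> p d < hi (block F i) d ->
  p d + 2 * e < hi (B' i) d.
Proof.
move=> adj; have /andP[? _] := moved_hi d adj; move: e_gt0 => ?.
by have [_ [?|?|?]] := blocks_clear i d; lra.
Qed.

Lemma moved_nondegenerate i d : adjacent F p i -> lo (B' i) d < hi (B' i) d.
Proof.
move=> adj; have /andP[_ ?] := moved_lo d adj.
have /andP[? _] := moved_hi d adj.
have lo_hi := block_nondegenerate F i d; have /andP[lo_p p_hi] := adj d.
move: e_gt0 => ?; have [hi_p|p_lt] := leP (hi (block F i) d) (p d).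
  by have := moved_lo_lt adj (lt_le_trans lo_hi hi_p); lra.
by have := moved_hi_gt adj p_lt; lra.
Qed.

(* The line through the octant s parallel to d: as its distance to p is larger
   than the displacements, a moved block contains points of it close to p only
   if the block occupies s or its neighbour across the plane orthogonal to d. *)
Definition probe s d x : point3 R :=
  fun k => if k == d then x else octant_point p s (2 * e) k.

Lemma probe_near s d x : `|x - p d| < e -> forall k, `|probe s d x k - p k| < r.
Proof.
rewrite /probe /octant_point => /ltr_normlP[? ?] k; apply/ltr_normlP.
move: e_gt0 e_r => ? ?.
by case: eqP => [->|_]; [split; lra|case: (s k) => /=; split; lra].
Qed.

Lemma probe_interior s d b i x : occupies (block F i) p (orient s d b) ->
  lo (B' i) d < x < hi (B' i) d -> box_interior (B' i) (probe s d x).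
Proof.
move=> occ x_in k; rewrite /probe /octant_point.
have [->//|kd] := eqVneq k d; have adj := occupies_box_set occ.
have /andP[_ ?] := moved_lo k adj; have /andP[? _] := moved_hi k adj.
move: e_gt0 => ?; have := occ k; rewrite orient_neq //.
case: (s k) => /= /andP[lo_p p_hi]; apply/andP.
  by have := moved_hi_gt adj p_hi; split; lra.
by have := moved_lo_lt adj lo_p; split; lra.
Qed.

Lemma probe_occupies s d x i : adjacent F p i -> box_set (B' i) (probe s d x) ->
  exists b, occupies (block F i) p (orient s d b).
Proof.
move=> adj in_i.
have [s' occ] := box_set_occupies (block_nondegenerate F i) adj.
exists (s' d) => k; rewrite /orient.
have [->|kd] := eqVneq k d; first exact: occ.
have /andP[lo_p p_hi] := adj k.
have := in_i k; rewrite /probe /octant_point (negbTE kd); move: e_gt0 => ?.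
have /andP[l1 l2] := moved_lo k adj; have /andP[h1 h2] := moved_hi k adj.
by case: (s k) => /= /andP[? ?]; apply/andP; split; lra.
Qed.

Lemma probe_covered s d x : `|x - p d| < e -> box_set (host F) (probe s d x) ->
  exists i b, occupies (block F i) p (orient s d b) /\
    lo (B' i) d <= x <= hi (B' i) d.
Proof.
move=> xp in_host; case: moved => _ _ /(_ _ (probe_near s xp)) [/(_ in_host)].
move=> [i [adj in_i]] _; have [b occ] := probe_occupies adj in_i.
by exists i, b; split=> //; have := in_i d; rewrite /probe eqxx.
Qed.

Lemma probe_sub_host s d b i x : `|x - p d| < e ->
  occupies (block F i) p (orient s d b) -> lo (B' i) d <= x <= hi (B' i) d ->
  box_set (host F) (probe s d x).
Proof.
move=> xp occ x_in; have adj := occupies_box_set occ.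
case: moved => _ _ /(_ _ (probe_near s xp)) [_]; apply; exists i; split=> // k.
have [->|kd] := eqVneq k d; first by rewrite /probe eqxx.
have mid_in : lo (B' i) d < (lo (B' i) d + hi (B' i) d) / 2 < hi (B' i) d.
  by have := moved_nondegenerate d adj => ?; apply/andP; split; lra.
have := box_interior_sub (probe_interior occ mid_in) k.
by rewrite /probe (negbTE kd).
Qed.

(* The line cannot leave the host between the two blocks of a wall, and cannot
   be in both of them. *)
Lemma wall_contact s d i j : wall_at F p d s i j -> hi (B' i) d = lo (B' j) d.
Proof.
move=> w; have [hi_i lo_j] := wall_faces w; case: w => occi occj ij.
have adj_i := occupies_box_set occi; have adj_j := occupies_box_set occj.
have := moved_hi d adj_i; rewrite hi_i => /andP[h1 h2].
have := moved_lo d adj_j; rewrite lo_j => /andP[l1 l2].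
have lo_i : lo (B' i) d < p d - 2 * e.
  by apply: moved_lo_lt; rewrite // -hi_i block_nondegenerate.
have hi_j : p d + 2 * e < hi (B' j) d.
  by apply: moved_hi_gt; rewrite // -lo_j block_nondegenerate.
move: e_gt0 => ?.
pose x := (hi (B' i) d + lo (B' j) d) / 2.
have xp : `|x - p d| < e by apply/ltr_normlP; rewrite /x; split; lra.
case: (ltgtP (hi (B' i) d) (lo (B' j) d)) => // hl.
- have x_host : box_set (host F) (probe s d x).
    have xi : box_set (host F) (probe s d (hi (B' i) d)).
      by apply: probe_sub_host occi _; [apply/ltr_normlP; split; lra|lra].
    have xj : box_set (host F) (probe s d (lo (B' j) d)).
      by apply: probe_sub_host occj _; [apply/ltr_normlP; split; lra|lra].
    move=> k; have := xi k; have := xj k; rewrite /probe /x.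
    by case: eqP => // -> /andP[? ?] /andP[? ?]; apply/andP; split; lra.
  have [t [[] [occt]]] := probe_covered xp x_host.
    by rewrite (occupant_unique occt occj) /x => /andP[? ?]; lra.
  by rewrite (occupant_unique occt occi) /x => /andP[? ?]; lra.
- case: moved => _ /(_ i j adj_i adj_j (introN eqP ij)) + _; rewrite -subset0.
  case/(_ (probe s d x)); split.
    by apply: probe_interior occi _; rewrite /x; lra.
  by apply: probe_interior occj _; rewrite /x; lra.
Qed.

Lemma host_face i d b : adjacent F p i -> bound b (block F i) d = p d ->
  bound b (host F) d = p d -> bound b (B' i) d = p d.
Proof.
move=> adj b_i b_host; have lo_hi := ltW (moved_nondegenerate d adj).
have [s occ] := box_set_occupies (block_nondegenerate F i) adj.
have sd := occupies_bound occ b_i; rewrite -(orient_id s d) sd in occ.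
have b_near : `|bound b (B' i) d - p d| < e.
  by rewrite -b_i; case: (b); case: moved => /(_ i adj d) [].
have b_probe : box_set (host F) (probe s d (bound b (B' i) d)).
  by apply: probe_sub_host b_near occ _; case: (b); rewrite /= lo_hi lexx.
have p_probe : box_set (host F) (probe s d (p d)).
  by move=> k; have := b_probe k; rewrite /probe; case: eqP => // ->.
have p_near : `|p d - p d| < e by rewrite subrr normr0.
have [j [c [occ_j]]] := probe_covered p_near p_probe.
have := occupies_bound (occupies_host occ_j) b_host; rewrite orient_eq => cb.
rewrite cb in occ_j; rewrite (occupant_unique occ_j occ).
have := b_probe d; rewrite /probe eqxx; move: b_host; clear.
by case: b => /= -> /andP[? ?] /andP[? ?]; lra.
Qed.

Lemma moved_planes d : rigid (V := R) (block_occupies F p) d ->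
  exists v, `|v - p d| < e /\ forall i b, adjacent F p i ->
    bound b (block F i) d = p d -> bound b (B' i) d = v.
Proof.
move=> rigid_d; have p_near : `|p d - p d| < e by rewrite subrr normr0.
have [[s0 [i0 [j0 w0]]]|no_wall] := pselect (exists s i j, wall_at F p d s i j).
  exists (hi (B' i0) d); split.
    have [<- _] := wall_faces w0; case: moved => /(_ i0 _ d) near_i0 _ _.
    by case: near_i0 => //; case: w0 => /occupies_box_set.
  have same := rigid_d (fun i => hi (B' i) d) (fun i => lo (B' i) d)
    (@wall_contact ^~ d).
  move=> i b adj b_i.
  have [s [j]] := face_inside_host adj b_i (wall_inside_host (b := b) w0).
  case: b {b_i} => w; first exact: same w w0.
  by rewrite /= -(wall_contact w); exact: same w w0.
exists (p d); split=> // i b adj b_i; apply: host_face => //.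
apply/eqP/negPn/negP => /eqP /(face_inside_host adj b_i)[s [j w]];
  apply: no_wall; exists s.
by case: b w {b_i} => w; [exists i, j|exists j, i].
Qed.

Lemma moved_occupies (v : point3 R) : (forall d, `|v d - p d| < e) ->
  (forall d i b, adjacent F p i -> bound b (block F i) d = p d ->
    bound b (B' i) d = v d) ->
  same_shape F p B' v.
Proof.
move=> v_near v_bound i adj s.
have near_v d b : (bound b (B' i) d < v d) = (bound b (block F i) d < p d) /\
    (v d < bound b (B' i) d) = (p d < bound b (block F i) d).
  have := v_near d; have := @v_bound d i b adj.
  have : `|bound b (B' i) d - bound b (block F i) d| < e.
    by case: moved => /(_ i adj d) [? ?] _ _; case: (b).
  have : clear_of e (p d) (bound b (block F i) d).
    by case: (b); have [] := blocks_clear i d.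
  move: e_gt0 => ? [?|->|?] /ltr_normlP[? ?] same /ltr_normlP[? ?].
  - by split; [apply/idP/idP|apply/negP/negP]; lra.
  - by rewrite same // !ltxx.
  - by split; apply/idP/idP; lra.
by split=> occ d; have := occ d; have [lo_v v_lo] := near_v d false;
  have [hi_v v_hi] := near_v d true; rewrite /= in lo_v v_lo hi_v v_hi;
  rewrite !leNgt lo_v v_lo hi_v v_hi.
Qed.

End Perturbation.

Lemma rigid_generic_corner (R : realType) (n : nat) (F : floorplan R n)
  (p : point3 R) :
  (forall d, rigid (V := R) (block_occupies F p) d) ->
  corner F p -> generic_corner F p.
Proof.
move=> rigid_p [i0 p_vertex] r r_gt0.
have p_host : box_set (host F) p.
  apply: (@block_sub_host _ _ _ i0) => d; have := block_nondegenerate F i0 d.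
  by case: (p_vertex d) => -> /ltW ->; rewrite lexx.
near (0 : R)^'+ => e; exists e; split=> [//|B' moved].
have e_gt0 : 0 < e by near: e; exact: nbhs_right_gt.
have e_r : 2 * e < r.
  rewrite mulrC -ltr_pdivlMr //; near: e.
  by apply: nbhs_right_lt; rewrite divr_gt0.
have blocks_clear : forall i, box_clear e p (block F i).
  by near: e; exact: near_blocks_clear.
have /choice[v vP] d := moved_planes e_gt0 e_r p_host blocks_clear moved
  (rigid_p d).
exists v; apply: (moved_occupies e_gt0 blocks_clear moved) => d.
  by case: (vP d).
by case: (vP d) => _; exact.
Unshelve. all: by end_near. Qed.

(** * Floor plans on the integer grid *)

Definition cell := 'I_3 -> nat.

Definition in_cells (l h c : cell) : Prop := forall d, (l d <= c d < h d)%N.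

Record tiling (T : finType) := Tiling {
  tiling_dims : cell;
  tile_low : T -> cell;
  tile_high : T -> cell;
  tile_owner : cell -> T;
  tile_bounds : forall b d, (tile_low b d < tile_high b d <= tiling_dims d)%N;
  tile_ownerP : forall c, (forall d, c d < tiling_dims d)%N ->
    forall b, in_cells (tile_low b) (tile_high b) c <-> tile_owner c = b
}.

(* Along one axis cut into unit cells, the cell on the given side of the
   coordinate n; [side_inside] excludes the junk value [side_cell 0 false]. *)
Definition side_cell (n : nat) (b : bool) : nat := if b then n else n.-1.

Definition side_inside (N n : nat) (b : bool) : bool :=
  if b then (n < N)%N else (0 < n <= N)%N.

Lemma side_cell_lt N n b : side_inside N n b -> (side_cell n b < N)%N.
Proof. by case: b => //=; lia. Qed.

Section GridFloorplan.
Context {R : realType} {T : finType} (t : tiling T).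
Implicit Types (P c : cell) (b : T) (d : 'I_3) (s : octant).

Definition grid_point c : point3 R := fun d => (c d)%:R.

Definition grid_box (l h : cell) : box R := Box (grid_point l) (grid_point h).

Definition tile_box b : box R := grid_box (tile_low t b) (tile_high t b).

Definition grid_host : box R := grid_box (fun=> 0%N) (tiling_dims t).

Lemma dims_gt0 d : (0 < tiling_dims t d)%N.
Proof. by have := tile_bounds t (tile_owner t (fun=> 0%N)) d; lia. Qed.

Lemma tile_box_nondegenerate b : nondegenerate (tile_box b).
Proof. by move=> d; rewrite /= ltr_nat; have /andP[] := tile_bounds t b d. Qed.

Lemma grid_host_nondegenerate : nondegenerate grid_host.
Proof. by move=> d; rewrite /= ltr_nat dims_gt0. Qed.

Lemma grid_host_cell (p : point3 R) : box_set grid_host p ->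
  exists c, (forall d, c d < tiling_dims t d)%N /\
    box_set (grid_box c (fun d => (c d).+1)) p.
Proof.
move=> p_host; exists (fun d => minn (Num.truncn (p d)) (tiling_dims t d).-1).
split=> d; first by have := dims_gt0 d; lia.
have /andP[p_ge0 p_le] := p_host d; have /andP[tp pt] := truncn_itv p_ge0.
rewrite /= /grid_point; case: leqP => [_|dims_le]; first by rewrite tp ltW.
by rewrite prednK ?dims_gt0 // p_le andbT (le_trans _ tp) // ler_nat ltnW.
Qed.

Lemma tile_box_cover : \bigcup_b box_set (tile_box b) = box_set grid_host.
Proof.
apply/seteqP; split=> [p [b _ p_b] d|p /grid_host_cell[c [c_lt p_c]]].
  have /andP[lo_p p_hi] := p_b d; have /andP[_ hi_le] := tile_bounds t b d.
  by rewrite (le_trans _ lo_p) ?ler0n //= (le_trans p_hi) // ler_nat.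
have own := (tile_ownerP c_lt (tile_owner t c)).2 erefl.
exists (tile_owner t c) => // d.
have /andP[lo_c c_hi] := own d; have /andP[c_p p_c1] := p_c d.
by rewrite /= (le_trans _ c_p) ?ler_nat //= (le_trans p_c1) ?ler_nat.
Qed.

Lemma grid_interior_cell (l h : cell) (p : point3 R) :
  box_interior (grid_box l h) p -> in_cells l h (fun d => Num.truncn (p d)).
Proof.
move=> p_in d; have /andP[/= l_p p_h] := p_in d.
have /andP[tp pt] : (Num.truncn (p d))%:R <= p d < (Num.truncn (p d)).+1%:R.
  by apply/truncn_itv/(le_trans _ (ltW l_p))/ler0n.
rewrite -(ltr_nat R) (le_lt_trans tp p_h) andbT -ltnS -(ltr_nat R).
exact: lt_trans pt.
Qed.

Lemma tile_box_disjoint b b' : b != b' ->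
  box_interior (tile_box b) `&` box_interior (tile_box b') = set0.
Proof.
move=> /eqP bb'; rewrite -subset0 => p [/grid_interior_cell p_b].
move=> /grid_interior_cell p_b'; apply: bb'.
have c_lt d : (Num.truncn (p d) < tiling_dims t d)%N.
  by have := p_b d; have := tile_bounds t b d; lia.
by rewrite -((tile_ownerP c_lt b).1 p_b) -((tile_ownerP c_lt b').1 p_b').
Qed.

Lemma grid_block_cover :
  \bigcup_(i : 'I_#|T|) box_set (tile_box (enum_val i)) = box_set grid_host.
Proof.
rewrite -tile_box_cover; apply/seteqP; split=> p [x _ p_x].
  by exists (enum_val x).
by exists (enum_rank x); rewrite ?enum_rankK.
Qed.

Lemma grid_block_disjoint (i j : 'I_#|T|) : i != j ->
  box_interior (tile_box (enum_val i)) `&`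
    box_interior (tile_box (enum_val j)) = set0.
Proof. by rewrite -(inj_eq enum_val_inj); exact: tile_box_disjoint. Qed.

Definition grid_floorplan : floorplan R #|T| :=
  @Floorplan R #|T| grid_host (fun i => tile_box (enum_val i))
    (fun=> erefl) grid_host_nondegenerate (fun i => @tile_box_nondegenerate _)
    grid_block_cover grid_block_disjoint.

Definition octant_cell P s : cell := fun k => side_cell (P k) (s k).

Definition octant_inside P s : Prop :=
  forall k, side_inside (tiling_dims t k) (P k) (s k).

Definition octant_owner P b s : Prop :=
  octant_inside P s /\ tile_owner t (octant_cell P s) = b.

Lemma octant_cell_lt P s : octant_inside P s ->
  forall k, (octant_cell P s k < tiling_dims t k)%N.
Proof. by move=> ins k; exact/side_cell_lt/ins. Qed.

Lemma grid_occupies P s (i : 'I_#|T|) :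
  occupies (block grid_floorplan i) (grid_point P) s <->
  octant_owner P (enum_val i) s.
Proof.
split=> [occ|[ins /(tile_ownerP (octant_cell_lt ins)) own] k].
  have ins : octant_inside P s.
    move=> k; have := occ k; rewrite /= !ler_nat !ltr_nat.
    by have := tile_bounds t (enum_val i) k; case: (s k) => /=; lia.
  split=> //; apply/(tile_ownerP (octant_cell_lt ins)) => k; have := occ k.
  rewrite /= !ler_nat !ltr_nat /octant_cell; case: (s k) => //=; lia.
have := own k; have := ins k; rewrite /octant_cell /= !ler_nat !ltr_nat.
by case: (s k) => //= ? ?; lia.
Qed.

Lemma grid_rigid P d : rigid (V := R) (octant_owner P) d ->
  rigid (V := R) (block_occupies grid_floorplan (grid_point P)) d.
Proof.
move=> rigid_P u v contact s s' i i' j j'.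
have wallE s0 i0 j0 : wall_at grid_floorplan (grid_point P) d s0 i0 j0 <->
    wall (octant_owner P) d s0 (enum_val i0) (enum_val j0).
  rewrite /wall_at /wall; split=> -[/grid_occupies ? /grid_occupies ? ij].
    by split=> // /enum_val_inj.
  by split=> // ij0; apply: ij; rewrite ij0.
move=> /wallE w /wallE w'; rewrite -(enum_valK i) -(enum_valK i').
apply: (rigid_P (u \o enum_rank) (v \o enum_rank) _ s s') w w' => s0 b0 b1 w0.
by apply/(contact s0)/wallE; rewrite !enum_rankK.
Qed.

Lemma grid_generic : (forall P d, rigid (V := R) (octant_owner P) d) ->
  generic grid_floorplan.
Proof.
move=> rigid_t p p_corner.
have [P PE] : exists P, p = grid_point P.
  have [i ip] := p_corner.
  have /choice[P PE] d : exists x : nat, p d = x%:R.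
    case: (ip d) => ->; first by exists (tile_low t (enum_val i) d).
    by exists (tile_high t (enum_val i) d).
  by exists P; apply/funext.
by apply: rigid_generic_corner => // d; rewrite PE; exact/grid_rigid.
Qed.

End GridFloorplan.

(** * Pillars, columns and rows *)

Record layout (S : finType) (L H : nat) := Layout {
  px : S -> nat;
  py : S -> nat;
  pillar_inj : forall s s', px s = px s' -> py s = py s' -> s = s';
  px_odd : forall s, odd (px s);
  py_odd : forall s, odd (py s);
  px_lt : forall s, (px s < L)%N;
  py_lt : forall s, (py s < H)%N
}.

Definition transpose (S : finType) (L H : nat) (A : layout S L H) :
    layout S H L :=
  Layout (fun s s' ys xs => pillar_inj xs ys) (py_odd A) (px_odd A) (py_lt A)
    (px_lt A).

Definition run (S : finType) (L : nat) : finType := (S + 'I_L.+1)%type.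

Section Runs.
Context {S : finType} {L H : nat} (A : layout S L H).
Implicit Types (s : S) (t : run S L) (x y : nat).

Definition pillar_at x y : option S :=
  [pick s | (px A s == x) && (py A s == y)].

Lemma pillar_atP x y s : pillar_at x y = Some s <-> px A s = x /\ py A s = y.
Proof.
rewrite /pillar_at; split=> [|[xs ys]]; case: pickP => //.
- by move=> s' /andP[/eqP xs /eqP ys] [<-].
- by move=> s' /andP[/eqP xs' /eqP ys']; congr Some;
    apply: (@pillar_inj _ _ _ A); lia.
- by move=> /(_ s); rewrite xs ys !eqxx.
Qed.

Lemma pillar_at_site s : pillar_at (px A s) (py A s) = Some s.
Proof. exact/pillar_atP. Qed.

Lemma pillar_at_odd x y : pillar_at x y -> odd x /\ odd y.
Proof.
case E: (pillar_at x y) => [s|//] _; have [<- <-] := (pillar_atP _ _ _).1 E.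
by rewrite px_odd py_odd.
Qed.

(* The run [inl s] of pillar-free cells comes after the pillar s in its column,
   the run [inr x] is at the beginning of the column x. *)
Definition run_column t : nat := match t with inl s => px A s | inr x => x end.

Definition run_start t : nat := if t is inl s then (py A s).+1 else 0%N.

Lemma run_stops t :
  exists y, (run_start t <= y)%N && (pillar_at (run_column t) y || (H < y)%N).
Proof.
by exists (maxn (run_start t) H.+1); rewrite leq_maxl leq_max ltnSn !orbT.
Qed.

Definition run_end t : nat := ex_minn (run_stops t).

Lemma run_end_eq t y : (run_start t <= y <= H.+1)%N ->
  (forall y', (run_start t <= y' < y)%N -> ~~ pillar_at (run_column t) y') ->
  pillar_at (run_column t) y || (H < y)%N -> run_end t = y.
Proof.
move=> /andP[st_y y_le] free stop; rewrite /run_end.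
case: ex_minnP => e /andP[st_e stop_e] e_min; have := e_min y.
rewrite st_y stop => /(_ isT); rewrite leq_eqVlt => /orP[/eqP //|e_y].
by move: stop_e; rewrite (negbTE (free e _)) ?st_e //=; lia.
Qed.

Lemma run_free t y : (run_start t <= y < run_end t)%N ->
  ~~ pillar_at (run_column t) y.
Proof.
rewrite /run_end; case: ex_minnP => e _ e_min /andP[st_y y_e].
by apply/negP => pil; have := e_min y; rewrite st_y pil => /(_ isT); lia.
Qed.

Lemma run_end_pillar t : (run_end t <= H)%N ->
  pillar_at (run_column t) (run_end t).
Proof.
by rewrite /run_end; case: ex_minnP => e /andP[_ /orP[//|H_e]] _ e_H; lia.
Qed.

Lemma run_bounds t : (run_start t < run_end t <= H.+1)%N.
Proof.
have st_H : (run_start t <= H)%N by case: t => //= s; exact: py_lt.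
have start_free : ~~ pillar_at (run_column t) (run_start t).
  apply/negP => /pillar_at_odd[_]; case: t {st_H} => //= s.
  by rewrite (py_odd A).
rewrite /run_end; case: ex_minnP => e /andP[st_e stop_e] e_min.
rewrite (e_min H.+1) ?ltnSn ?orbT ?andbT ?(leqW st_H) //.
rewrite ltn_neqAle st_e andbT; apply: contra start_free => /eqP st_E.
by move: stop_e; rewrite -st_E => /orP[//|]; lia.
Qed.

Lemma run_column_lt t : (run_column t < L.+1)%N.
Proof. by case: t => [s|x] /=; [exact/ltnW/px_lt|]. Qed.

Fixpoint run_at x y : run S L :=
  if y is y'.+1 then
    if pillar_at x y' is Some s then inl s else run_at x y'
  else inr (inord x).

Lemma run_at_step x y : ~~ pillar_at x y -> run_at x y.+1 = run_at x y.
Proof. by rewrite /=; case: pillar_at. Qed.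

Lemma run_at_start t : run_at (run_column t) (run_start t) = t.
Proof. by case: t => [s|x] /=; rewrite ?pillar_at_site ?inord_val. Qed.

Lemma run_at_free x y y' : (y <= y')%N ->
  (forall z, (y <= z < y')%N -> ~~ pillar_at x z) -> run_at x y' = run_at x y.
Proof.
elim: y' => [|y' IH]; first by rewrite leqn0 => /eqP ->.
rewrite leq_eqVlt => /orP[/eqP -> //|y_y'] free.
rewrite run_at_step; first by apply: IH => // z z_in; apply: free; lia.
by apply: free; lia.
Qed.

Lemma run_at_column x y : (x <= L)%N ->
  run_column (run_at x y) = x /\ (run_start (run_at x y) <= y)%N.
Proof.
move=> x_le; elim: y => [|y [col st]] /=; first by rewrite inordK.
case E: (pillar_at x y) => [s|]; last by rewrite col (leqW st).
by have [xs ys] := (pillar_atP _ _ _).1 E; rewrite /= xs ys.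
Qed.

Lemma run_at_no_pillar x y z : (run_start (run_at x y) <= z < y)%N ->
  ~~ pillar_at x z.
Proof.
elim: y => [|y IH] /=; first by lia.
case E: (pillar_at x y) => [s|]; last first.
  by case: (eqVneq z y) => [->|zy z_in]; [rewrite E|apply: IH; lia].
by have [_ ys] := (pillar_atP _ _ _).1 E; rewrite /= ys; lia.
Qed.

Lemma run_atP t x y : (x <= L)%N -> (y <= H)%N ->
  run_column t = x /\ (run_start t <= y < run_end t)%N <->
  ~~ pillar_at x y /\ run_at x y = t.
Proof.
move=> x_le y_le; split=> [[<- /andP[st_y y_end]]|[free <-]].
  split; first by apply: run_free; rewrite st_y.
  rewrite -[RHS]run_at_start; apply: run_at_free => // z z_in.
  by apply: run_free; lia.
have [col st] := run_at_column y x_le; split=> //; rewrite st /= /run_end.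
case: ex_minnP => e /andP[st_e]; rewrite col => stop_e _; rewrite ltnNge.
apply: contraNN free => e_y.
have pil_e : pillar_at x e by case/orP: stop_e => //; lia.
have [<- //|ne_y] := eqVneq e y; have := @run_at_no_pillar x y e.
by rewrite pil_e st_e => /(_ _)/negP[]; lia.
Qed.

End Runs.

Lemma pillar_at_transpose (S : finType) (L H : nat) (A : layout S L H) x y :
  pillar_at (transpose A) y x = pillar_at A x y.
Proof. by apply: eq_pick => s; rewrite andbC. Qed.

Definition xdir : 'I_3 := ord0.
Definition ydir : 'I_3 := @Ordinal 3 1 isT.

Lemma forall_dir (Q : 'I_3 -> Prop) :
  Q xdir -> Q ydir -> Q zdir -> forall d, Q d.
Proof.
move=> Qx Qy Qz [[|[|[|//]]] lt_d3].
- by rewrite (_ : Ordinal _ = xdir) //; apply: val_inj.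
- by rewrite (_ : Ordinal _ = ydir) //; apply: val_inj.
- by rewrite (_ : Ordinal _ = zdir) //; apply: val_inj.
Qed.

Definition vec3 {V : Type} (x y z : V) : 'I_3 -> V :=
  fun d => nth x [:: x; y; z] d.

Lemma in_cells_vec3 x y z x' y' z' c :
  in_cells (vec3 x y z) (vec3 x' y' z') c <->
  [&& x <= c xdir < x', y <= c ydir < y' & z <= c zdir < z']%N.
Proof.
split=> [c_in|/and3P[? ? ?]]; last exact: forall_dir.
apply/and3P; split.
- exact: (c_in xdir).
- exact: (c_in ydir).
- exact: (c_in zdir).
Qed.

Definition block_label (S : finType) (L H : nat) : finType :=
  (S + run S L + run S H)%type.

Local Notation Pillar s := (inl (inl s)).
Local Notation Column t := (inl (inr t)).
Local Notation Row t := (inr t).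

Section PillarTiling.
Context {S : finType} {L H : nat} (A : layout S L H).
Implicit Types (x y : nat) (top : bool).

Definition block_low (b : block_label S L H) : cell :=
  match b with
  | Pillar s => vec3 (px A s) (py A s) 0%N
  | Column t => vec3 (run_column A t) (run_start A t) 0%N
  | Row t => vec3 (run_start (transpose A) t) (run_column (transpose A) t) 1%N
  end.

Definition block_high (b : block_label S L H) : cell :=
  match b with
  | Pillar s => vec3 (px A s).+1 (py A s).+1 2%N
  | Column t => vec3 (run_column A t).+1 (run_end A t) 1%N
  | Row t => vec3 (run_end (transpose A) t) (run_column (transpose A) t).+1 2%N
  end.

Definition block_at x y top : block_label S L H :=
  if pillar_at A x y is Some s then Pillar s
  else if top then Row (run_at (transpose A) y x) else Column (run_at A x y).

Lemma block_at_eq_pillar x y top s :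
  block_at x y top = Pillar s <-> px A s = x /\ py A s = y.
Proof.
rewrite -pillar_atP /block_at; split=> [|-> //].
by case: pillar_at => [s' [->]|] //; case: top.
Qed.

Lemma block_at_eq_column x y top t : block_at x y top = Column t <->
  [/\ ~~ top, ~~ pillar_at A x y & run_at A x y = t].
Proof.
rewrite /block_at; case: pillar_at => [s|]; first by split=> // -[].
by case: top; [split=> // -[]|split=> [[->]|[_ _ ->]]].
Qed.

Lemma block_at_eq_row x y top t : block_at x y top = Row t <->
  [/\ top, ~~ pillar_at A x y & run_at (transpose A) y x = t].
Proof.
rewrite /block_at; case: pillar_at => [s|]; first by split=> // -[].
by case: top; [split=> [[->]|[_ _ ->]]|split=> // -[]].
Qed.

Definition pillar_dims : cell := vec3 L.+1 H.+1 2%N.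

Definition pillar_owner (c : cell) : block_label S L H :=
  block_at (c xdir) (c ydir) (c zdir == 1%N).

Lemma block_bounds b d : (block_low b d < block_high b d <= pillar_dims d)%N.
Proof.
move: d; case: b => [[s|t]|t]; apply: forall_dir => //=;
  rewrite /vec3 /= ?ltnSn /=.
- exact/ltnW/px_lt.
- exact/ltnW/py_lt.
- exact: run_column_lt.
- exact: run_bounds.
- exact: run_bounds.
- exact: run_column_lt.
Qed.

Lemma pillar_ownerP c : (forall d, c d < pillar_dims d)%N ->
  forall b, in_cells (block_low b) (block_high b) c <-> pillar_owner c = b.
Proof.
move=> c_lt b; have x_le : (c xdir <= L)%N := c_lt xdir.
have y_le : (c ydir <= H)%N := c_lt ydir.
have z_lt : (c zdir < 2)%N := c_lt zdir.
rewrite /pillar_owner; case: b => [[s|t]|t]; rewrite in_cells_vec3.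
- by rewrite block_at_eq_pillar; split=> [/and3P[]|[]]; lia.
- have run_in := run_atP A t x_le y_le; rewrite block_at_eq_column.
  split=> [/and3P[x_in y_in z_in]|[z_neq1 free run_t]].
    have [|free run_t] := run_in.1 (conj _ y_in); first by lia.
    by split=> //; lia.
  by have [x_t y_t] := run_in.2 (conj free run_t); apply/and3P; split; lia.
- have run_in := run_atP (transpose A) t y_le x_le.
  rewrite pillar_at_transpose in run_in; rewrite block_at_eq_row.
  split=> [/and3P[x_in y_in z_in]|[z_eq1 free run_t]].
    have [|free run_t] := run_in.1 (conj _ x_in); first by lia.
    by split=> //; lia.
  by have [y_t x_t] := run_in.2 (conj free run_t); apply/and3P; split; lia.
Qed.

Definition pillar_tiling : tiling (block_label S L H) :=
  Tiling block_bounds pillar_ownerP.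

Lemma block_at_pillar x y top top' : pillar_at A x y ->
  block_at x y top = block_at x y top'.
Proof. by rewrite /block_at; case: pillar_at. Qed.

Lemma block_at_layers x y : ~~ pillar_at A x y ->
  block_at x y false <> block_at x y true.
Proof. by rewrite /block_at; case: pillar_at. Qed.

Lemma block_at_column_inj x x' y : (x <= L)%N -> (x' <= L)%N ->
  block_at x y false = block_at x' y false -> x = x'.
Proof.
move=> x_le x'_le; rewrite /block_at.
case E: pillar_at => [s|]; case E': pillar_at => [s'|] // [].
  by move: E E' => /pillar_atP[<- _] /pillar_atP[<- _] ->.
move=> /(congr1 (run_column A)).
by rewrite (run_at_column A y x_le).1 (run_at_column A y x'_le).1.
Qed.

Lemma block_at_row_inj x y y' : (y <= H)%N -> (y' <= H)%N ->
  block_at x y true = block_at x y' true -> y = y'.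
Proof.
move=> y_le y'_le; rewrite /block_at.
case E: pillar_at => [s|]; case E': pillar_at => [s'|] // [].
  by move: E E' => /pillar_atP[_ <-] /pillar_atP[_ <-] ->.
move=> /(congr1 (run_column (transpose A))).
by rewrite (run_at_column _ x y_le).1 (run_at_column _ x y'_le).1.
Qed.

Lemma column_step x y : ~~ pillar_at A x y -> ~~ pillar_at A x y.+1 ->
  block_at x y.+1 false = block_at x y false.
Proof.
rewrite /block_at => free; case: (pillar_at A x y.+1) => // _.
by rewrite (run_at_step free); case: pillar_at free.
Qed.

Lemma row_step x y : ~~ pillar_at A x y -> ~~ pillar_at A x.+1 y ->
  block_at x.+1 y true = block_at x y true.
Proof.
rewrite /block_at => free; case: (pillar_at A x.+1 y) => // _.
by rewrite run_at_step ?pillar_at_transpose //; case: pillar_at free.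
Qed.

End PillarTiling.

(** * Rigidity around pillars *)

(* The blocks around a vertical line through a lattice point: o a b top is the
   one in the quadrant (a, b) of the given layer. The bottom blocks are columns,
   going on along y, and the top blocks are rows, going on along x, except at
   the only quadrant that may contain a pillar. *)
Record crossing (T : Type) (X Y : pred bool) (pil : rel bool)
    (o : bool -> bool -> bool -> T) : Prop := Crossing {
  crossing_single_pillar : exists a0 b0,
    forall a b, pil a b -> a = a0 /\ b = b0;
  crossing_pillar_layers : forall a b top top', pil a b ->
    o a b top = o a b top';
  crossing_free_layers : forall a b, ~~ pil a b -> o a b false <> o a b true;
  crossing_column_along : forall a, X a -> Y false -> Y true ->
    ~~ pil a false -> ~~ pil a true -> o a false false = o a true false;
  crossing_row_along : forall b, Y b -> X false -> X true ->
    ~~ pil false b -> ~~ pil true b -> o false b true = o true b true;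
  crossing_columns_neq : forall b, Y b -> X false -> X true ->
    o false b false <> o true b false;
  crossing_rows_neq : forall a, X a -> Y false -> Y true ->
    o a false true <> o a true true
}.

Lemma crossing_transpose (T : Type) (X Y : pred bool) (pil : rel bool)
    (o : bool -> bool -> bool -> T) : crossing X Y pil o ->
  crossing Y X (fun b a => pil a b) (fun b a top => o a b (~~ top)).
Proof.
case=> -[a0 [b0 single]] layers free column row columns rows.
split=> /=; [exists b0, a0|..|exact: rows|exact: columns].
- by move=> b a /single[].
- by move=> b a top top'; exact: layers.
- by move=> b a /free ne /esym.
- by move=> b; exact: row.
- by move=> a; exact: column.
Qed.

Section CrossingRigidity.
Context {T V : Type} (X Y : pred bool) (pil : rel bool).
Context (o : bool -> bool -> bool -> T) (u v : T -> V).
Hypothesis o_crossing : crossing X Y pil o.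
Implicit Types a b top : bool.

Section Across.
Context (layer : bool -> Prop).
Hypotheses (X_false : X false) (X_true : X true).
Hypothesis contact : forall b top, Y b -> layer top ->
  o false b top <> o true b top -> u (o false b top) = v (o true b top).

Lemma column_contact b : layer false -> Y b ->
  u (o false b false) = v (o true b false).
Proof.
by move=> bottom Yb; apply/contact/(crossing_columns_neq o_crossing).
Qed.

(* One of the two columns on both sides has no pillar. *)
Lemma columns_glued b b' : layer false -> Y b -> Y b' ->
  u (o false b false) = u (o false b' false).
Proof.
move=> bottom; suff glued : Y false -> Y true ->
  u (o false false false) = u (o false true false).
  by case: b; case: b' => // Yb Yb'; rewrite glued.
move=> Y0 Y1; have [a0 [b0 single]] := crossing_single_pillar o_crossing.
have free b1 : ~~ pil (~~ a0) b1 by apply/negP => /single[]; case: (a0).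
case: a0 free {single} => free.
  by rewrite (crossing_column_along o_crossing X_false Y0 Y1) ?free.
by rewrite !column_contact // (crossing_column_along o_crossing X_true Y0 Y1)
  ?free.
Qed.

Lemma row_wall_pillar b : Y b -> o false b true <> o true b true ->
  pil false b || pil true b.
Proof.
move=> Yb; apply: contra_notT; rewrite negb_or => /andP[? ?].
exact: (crossing_row_along o_crossing).
Qed.

Lemma row_wall_glued b : layer false -> layer true -> Y b ->
  o false b true <> o true b true -> u (o false b true) = u (o false b false).
Proof.
move=> bottom top_layer Yb ne; have /orP[] := row_wall_pillar Yb ne => pillar.
  by rewrite (crossing_pillar_layers o_crossing true false pillar).
rewrite contact // (crossing_pillar_layers o_crossing true false pillar).
by rewrite column_contact.
Qed.

Lemma crossing_rigid_across b b' top top' :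
  Y b -> Y b' -> layer top -> layer top' ->
  o false b top <> o true b top -> o false b' top' <> o true b' top' ->
  u (o false b top) = u (o false b' top').
Proof.
case: top; case: top' => Yb Yb' layer_top layer_top' ne ne'.
- have [a0 [b0 single]] := crossing_single_pillar o_crossing.
  have pillar_b b1 : pil false b1 || pil true b1 -> b1 = b0
    by case/orP => /single[].
  by rewrite (pillar_b b (row_wall_pillar Yb ne))
    (pillar_b b' (row_wall_pillar Yb' ne')).
- by rewrite row_wall_glued //; exact: columns_glued.
- by rewrite (row_wall_glued layer_top layer_top' Yb' ne');
    exact: columns_glued.
- exact: columns_glued.
Qed.

End Across.

Section Vertical.
Hypothesis contact : forall a b, X a -> Y b ->
  o a b false <> o a b true -> u (o a b false) = v (o a b true).

Lemma free_contact a b : X a -> Y b -> ~~ pil a b ->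
  u (o a b false) = v (o a b true).
Proof.
by move=> Xa Yb free; apply/contact/(crossing_free_layers o_crossing).
Qed.

Lemma glued_along_column a b b' :
  X a -> Y b -> Y b' -> ~~ pil a b -> ~~ pil a b' ->
  u (o a b false) = u (o a b' false).
Proof.
move=> Xa; case: b; case: b' => // Yb Yb' free free'.
  by rewrite -(crossing_column_along o_crossing Xa).
by rewrite (crossing_column_along o_crossing Xa).
Qed.

Lemma glued_along_row a a' b :
  X a -> X a' -> Y b -> ~~ pil a b -> ~~ pil a' b ->
  u (o a b false) = u (o a' b false).
Proof.
move=> Xa Xa' Yb free free'; rewrite !free_contact //.
case: a a' Xa Xa' free free' => -[] // Xa Xa' free free'.
  by rewrite -(crossing_row_along o_crossing Yb).
by rewrite (crossing_row_along o_crossing Yb).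
Qed.

(* As there is at most one pillar, it misses one of the two ways from (a, b) to
   (a', b') around the line. *)
Lemma crossing_rigid_vertical a b a' b' : X a -> Y b -> X a' -> Y b' ->
  o a b false <> o a b true -> o a' b' false <> o a' b' true ->
  u (o a b false) = u (o a' b' false).
Proof.
have free a1 b1 : o a1 b1 false <> o a1 b1 true -> ~~ pil a1 b1.
  by apply: contra_notN; exact: (crossing_pillar_layers o_crossing).
move=> Xa Yb Xa' Yb' /free free_ab /free free_ab'.
have [free_ab1|pil_ab'] := boolP (pil a b'); last first.
  by rewrite (glued_along_column Xa Yb Yb') //; exact: glued_along_row.
have [pil_a'b|free_a'b] := boolP (pil a' b); last first.
  by rewrite (glued_along_row Xa Xa' Yb) //; exact: glued_along_column.
have [a0 [b0 single]] := crossing_single_pillar o_crossing.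
have [-> _] := single _ _ pil_a'b; have [_ ->] := single _ _ free_ab1.
by have [-> _] := single _ _ free_ab1; have [_ ->] := single _ _ pil_a'b.
Qed.

End Vertical.
End CrossingRigidity.

Section PillarRigidity.
Context {S : finType} {L H : nat} (A : layout S L H).

Lemma odd_side_cell n b : odd (side_cell n b) -> b = odd n.
Proof. by case: b => //=; case: n => //= n; case: odd. Qed.

Lemma side_cellS N n : side_inside N n false ->
  side_cell n true = (side_cell n false).+1.
Proof. by case: n. Qed.

Lemma pillar_crossing x y :
  crossing (side_inside L.+1 x) (side_inside H.+1 y)
    (fun a b => pillar_at A (side_cell x a) (side_cell y b))
    (fun a b => block_at A (side_cell x a) (side_cell y b)).
Proof.
split.
- exists (odd x), (odd y) => a b /pillar_at_odd[].
  by move=> /odd_side_cell -> /odd_side_cell.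
- by move=> a b top top'; exact: block_at_pillar.
- by move=> a b; exact: block_at_layers.
- by move=> a _ y0 _; rewrite (side_cellS y0) => ? ?; rewrite column_step.
- by move=> b _ x0 _; rewrite (side_cellS x0) => ? ?; rewrite row_step.
- move=> b _ x0 x1 eq_b.
  have x0_le : (side_cell x false <= L)%N := side_cell_lt x0.
  have x1_le : (side_cell x true <= L)%N := side_cell_lt x1.
  have := block_at_column_inj x0_le x1_le eq_b.
  by rewrite (side_cellS x0); lia.
- move=> a _ y0 y1 eq_a.
  have y0_le : (side_cell y false <= H)%N := side_cell_lt y0.
  have y1_le : (side_cell y true <= H)%N := side_cell_lt y1.
  have := block_at_row_inj y0_le y1_le eq_a.
  by rewrite (side_cellS y0); lia.
Qed.

Definition layer_touches (z : nat) (top : bool) : Prop :=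
  exists2 c, side_inside 2 z c & (side_cell z c == 1%N) = top.

Lemma pillar_rigid_x {V : Type} P :
  rigid (V := V) (octant_owner (pillar_tiling A) P) xdir.
Proof.
move=> u v contact s s' i i' j j'.
move=> [[ins0 <-] [ins1 <-] ne] [[ins0' <-] [ins1' <-] ne'].
have crossingP := pillar_crossing (P xdir) (P ydir).
apply: (crossing_rigid_across (v := v) crossingP
  (layer := layer_touches (P zdir))
  (ins0 xdir) (ins1 xdir) _ (ins0 ydir) (ins0' ydir) _ _ ne ne').
- move=> b top Yb [c Zc <-] ne_b; apply: (contact (vec3 false b c)).
  by split=> //; split=> //; exact: forall_dir.
- by exists (s zdir); first exact: (ins0 zdir).
- by exists (s' zdir); first exact: (ins0' zdir).
Qed.

Lemma pillar_rigid_y {V : Type} P :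
  rigid (V := V) (octant_owner (pillar_tiling A) P) ydir.
Proof.
move=> u v contact s s' i i' j j'.
move=> [[ins0 <-] [ins1 <-] ne] [[ins0' <-] [ins1' <-] ne'].
have crossingP := crossing_transpose (pillar_crossing (P xdir) (P ydir)).
pose top r := side_cell (P zdir) (r zdir) == 1%N.
have := crossing_rigid_across (u := u) (v := v) crossingP
  (layer := fun k => layer_touches (P zdir) (~~ k)) (ins0 ydir) (ins1 ydir) _
  (ins0 xdir) (ins0' xdir) (top := ~~ top s) (top' := ~~ top s').
rewrite /= !negbK; apply=> //.
- move=> a k Xa [c Zc <-] ne_a; apply: (contact (vec3 a false c)).
  by split=> //; split=> //; exact: forall_dir.
- by exists (s zdir); first exact: (ins0 zdir).
- by exists (s' zdir); first exact: (ins0' zdir).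
Qed.

Lemma pillar_rigid_z {V : Type} P :
  rigid (V := V) (octant_owner (pillar_tiling A) P) zdir.
Proof.
move=> u v contact s s' i i' j j'.
move=> [[ins0 <-] [ins1 <-] ne] [[ins0' <-] [ins1' <-] ne'].
have Pz : P zdir = 1%N.
  have : side_inside 2 (P zdir) false := ins0 zdir.
  by have : side_inside 2 (P zdir) true := ins1 zdir; rewrite /side_inside; lia.
have layerE b r : pillar_owner A (octant_cell P (orient r zdir b)) =
    block_at A (side_cell (P xdir) (r xdir)) (side_cell (P ydir) (r ydir)) b.
  by rewrite /pillar_owner /octant_cell orient_eq Pz; case: b.
rewrite /= !layerE in ne ne' *.
apply: (crossing_rigid_vertical (v := v) (pillar_crossing (P xdir) (P ydir))
  _ (ins0 xdir) (ins0 ydir) (ins0' xdir) (ins0' ydir) ne ne').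
move=> a b Xa Yb ne_ab; apply: (contact (vec3 a b false)).
have inside_ab c :
    octant_inside (pillar_tiling A) P (orient (vec3 a b false) zdir c).
  by apply: forall_dir => //; rewrite orient_eq Pz; case: c.
by split=> //; split=> //; rewrite /= layerE.
Qed.

End PillarRigidity.

Definition pillar_floorplan (R : realType) (S : finType) (L H : nat)
    (A : layout S L H) : floorplan R #|{: block_label S L H}| :=
  grid_floorplan (pillar_tiling A).

Lemma pillar_floorplan_generic (R : realType) (S : finType) (L H : nat)
    (A : layout S L H) : generic (pillar_floorplan R A).
Proof.
apply: grid_generic => P; apply: forall_dir.
- exact: pillar_rigid_x.
- exact: pillar_rigid_y.
- exact: pillar_rigid_z.
Qed.

Lemma pillar_floorplan_two_layer (R : realType) (S : finType) (L H : nat)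
    (A : layout S L H) : two_layer (pillar_floorplan R A).
Proof.
exists 1; split=> [|i /=]; first by rewrite ltr01 ltr1n.
by case: (enum_val i) => [[s|t]|t]; [constructor 3|constructor 1|constructor 2].
Qed.

(** * Dissection graphs *)

Section DissectionPlanes.
Context {R : realType} {n : nat} (F : floorplan R n) (d : 'I_3).
Implicit Types f g : face n.

Lemma overlap_areaC f g : overlap_area F d f g = overlap_area F d g f.
Proof.
rewrite /overlap_area eq_sym; case: ifP => // _; apply: eq_bigr => k _.
by rewrite minC [X in _ - X]maxC.
Qed.

Lemma attached_connect_sym : connect_sym (attached F d).
Proof.
by apply: sym_connect_sym => f g; rewrite /attached /= overlap_areaC.
Qed.

Lemma overlap_area_gt0 f g : face_coord F d f = face_coord F d g ->
  (forall k, k != d -> lo (block F f.1) k < hi (block F g.1) k /\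
     lo (block F g.1) k < hi (block F f.1) k) ->
  0 < overlap_area F d f g.
Proof.
move=> fg overlap; rewrite /overlap_area fg eqxx.
apply: prodr_gt0 => k kd; rewrite lt_max subr_gt0 lt_min !gt_max.
have [-> ->] := overlap k kd; rewrite !andbT /=.
by rewrite (block_nondegenerate F f.1 k) (block_nondegenerate F g.1 k) orbT.
Qed.

Lemma connect_face_coord f g :
  connect (attached F d) f g -> face_coord F d f = face_coord F d g.
Proof.
case/connectP => p + ->; elim: p f => //= h p IH f /andP[fh hp].
rewrite -(IH _ hp); move: fh; rewrite /attached /= /overlap_area.
by case: eqP => //; rewrite ltxx.
Qed.

Lemma eq_plane f g : plane F d f = plane F d g <-> connect (attached F d) f g.
Proof.
split=> [/(congr1 val) /= /setP/(_ g)|fg]; first by rewrite !inE connect0.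
apply/val_inj/setP => k; rewrite !inE.
exact: (same_connect attached_connect_sym fg).
Qed.

End DissectionPlanes.

Section GraphIsomorphism.
Context {R : realType} {n : nat} (F G : floorplan R n) (d : 'I_3) (N : nat).
Context (cF cG : face n -> nat).
Hypothesis G_coord : forall f, face_coord G d f = (cG f)%:R.
Hypothesis G_le : forall f, (cG f <= N)%N.
Hypothesis unit_steps : forall x, (x < N)%N ->
  exists i, cF (i, false) = x /\ cF (i, true) = x.+1.
Hypothesis one_plane : forall f g, (0 < cF f < N)%N -> cF f = cF g ->
  plane F d f = plane F d g.

(* The unit steps of F form a directed path of length N through all its interior
   planes; its image in G advances by at least one at each step and has only N
   to go, so that it keeps the coordinates. *)
Lemma isomorphism_keeps_coords :
  isomorphic (dissection_graph F d) (dissection_graph G d) ->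
  exists psi : 'I_n -> 'I_n,
    forall f, (0 < cF f < N)%N -> cG (psi f.1, f.2) = cF f.
Proof.
case=> [phi [psi [_ _ src tgt]]]; exists psi.
have phi_plane f : plane G d (psi f.1, f.2) = phi (plane F d f).
  by case: f => i []; [exact: tgt|exact: src].
have same f g : (0 < cF f < N)%N -> cF f = cF g ->
    cG (psi f.1, f.2) = cG (psi g.1, g.2).
  move=> f_int fg; apply/eqP; rewrite -(eqr_nat R) -!G_coord; apply/eqP.
  by apply/connect_face_coord/eq_plane; rewrite !phi_plane (one_plane f_int fg).
have step i : (cG (psi i, false) < cG (psi i, true))%N.
  by rewrite -(ltr_nat R) -!G_coord; exact: block_nondegenerate.
have ge x f : cF f = x -> (x < N)%N -> (x <= cG (psi f.1, f.2))%N.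
  elim: x f => // x IH f fx x_lt; have [i [ix ix1]] := unit_steps (ltnW x_lt).
  rewrite (same f (i, true)) ?fx ?ix1 //.
  exact: leq_ltn_trans (IH (i, false) ix (ltnW x_lt)) (step i).
have le y f : (0 < cF f)%N -> (cF f + y)%N = N -> (cG (psi f.1, f.2) <= cF f)%N.
  elim: y f => [|y IH] f f_gt0 fy; first by rewrite -[cF f]addn0 fy.
  have f_lt : (cF f < N)%N by lia.
  have [i [ix ix1]] := unit_steps f_lt.
  rewrite (same f (i, false)) ?f_gt0 ?ix //= -ltnS -ix1.
  by apply: leq_trans (step i) (IH (i, true) _ _); rewrite ix1 //; lia.
move=> f /andP[f_gt0 f_lt]; apply/eqP.
rewrite eqn_leq (ge _ _ erefl f_lt) andbT.
by apply: (le (N - cF f)%N) => //; lia.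
Qed.

End GraphIsomorphism.

Section GridFaces.
Context {R : realType} {T : finType} (t : tiling T).

Definition tile_coord (d : 'I_3) (b : T) (up : bool) : nat :=
  if up then tile_high t b d else tile_low t b d.

Lemma grid_face_coord d (f : face #|T|) :
  face_coord (grid_floorplan (R := R) t) d f =
  (tile_coord d (enum_val f.1) f.2)%:R.
Proof. by case: f => i []. Qed.

Lemma tile_coord_le d b up : (tile_coord d b up <= tiling_dims t d)%N.
Proof.
have /andP[low_high high_le] := tile_bounds t b d.
by case: up => //; exact: leq_trans (ltnW low_high) high_le.
Qed.

Definition tile_face (b : T) (up : bool) : face #|T| := (enum_rank b, up).

Lemma tile_face_eta (f : face #|T|) : tile_face (enum_val f.1) f.2 = f.
Proof. by case: f => i up; rewrite /tile_face enum_valK. Qed.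

Lemma tile_face_attached d b b' up up' :
  tile_coord d b up = tile_coord d b' up' ->
  (forall k, k != d -> (tile_low t b k < tile_high t b' k)%N /\
    (tile_low t b' k < tile_high t b k)%N) ->
  attached (grid_floorplan (R := R) t) d (tile_face b up) (tile_face b' up').
Proof.
move=> coord overlap; apply: overlap_area_gt0 => [|k /overlap].
  by rewrite !grid_face_coord /= !enum_rankK coord.
by rewrite /= !enum_rankK !ltr_nat.
Qed.

End GridFaces.

Section PillarPlanes.
Context {R : realType} {S : finType} {L H : nat} (A : layout S L H).
Implicit Types (b : block_label S L H) (up : bool) (x : nat).

Local Notation F := (pillar_floorplan R A).
Local Notation xcoord := (tile_coord (pillar_tiling A) xdir).

(* Of the two columns next to the plane with abscissa x, the even one: it is not
   cut by any pillar. *)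
Definition spine x : block_label S L H :=
  Column (inr (inord (if odd x then x.-1 else x))).

Lemma spine_coord x : (0 < x <= L)%N -> xcoord (spine x) (odd x) = x.
Proof.
move=> x_int; rewrite /tile_coord /spine.
by case ox: (odd x); rewrite /= /vec3 /= inordK; lia.
Qed.

Lemma spine_uncut x : (0 < x <= L)%N -> block_high A (spine x) ydir = H.+1.
Proof.
move=> x_int; apply: run_end_eq => //=; last by rewrite ltnSn orbT.
move=> y _; apply/negP => /pillar_at_odd[].
by rewrite inordK; case: ifP => ox; lia.
Qed.

Lemma bottom_face_on_spine x b up : (0 < x <= L)%N -> xcoord b up = x ->
  block_low A b zdir = 0%N ->
  attached F xdir (tile_face b up) (tile_face (spine x) (odd x)).
Proof.
move=> x_int bx bottom; apply: tile_face_attached.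
  by rewrite bx spine_coord.
have /andP[y_lt y_le] := block_bounds A b ydir.
have /andP[z_lt _] := block_bounds A b zdir.
apply: forall_dir => // _; split.
- by rewrite [tile_high _ _ _](spine_uncut x_int); exact: leq_trans y_lt y_le.
- exact: leq_ltn_trans (leq0n _) y_lt.
- by rewrite [tile_low _ _ _]bottom.
- exact: leq_ltn_trans (leq0n _) z_lt.
Qed.

Lemma row_end_pillar (t : run S H) up x : (0 < x <= L)%N ->
  xcoord (Row t) up = x ->
  exists s, xcoord (Pillar s) (~~ up) = x /\
    py A s = run_column (transpose A) t.
Proof.
rewrite /tile_coord => /andP[x_gt0 x_le]; case: up; rewrite /= /vec3 /= => tx.
  have := run_end_pillar (A := transpose A) (t := t); rewrite tx.
  rewrite pillar_at_transpose => /(_ x_le).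
  by case E: pillar_at => [s|//] _; exists s; apply/pillar_atP.
by case: t tx => [s|y] tx; [exists s|move: x_gt0; rewrite -tx].
Qed.

Lemma row_attached_pillar (t : run S H) s up up' :
  xcoord (Row t) up = xcoord (Pillar s) up' ->
  py A s = run_column (transpose A) t ->
  attached F xdir (tile_face (Row t) up) (tile_face (Pillar s) up').
Proof.
move=> coord row; apply: tile_face_attached => //.
by apply: forall_dir => // _; rewrite /= /vec3 /= row ?ltnSn.
Qed.

Lemma connect_spine x b up : (0 < x <= L)%N -> xcoord b up = x ->
  connect (attached F xdir) (tile_face b up) (tile_face (spine x) (odd x)).
Proof.
move=> x_int; case: b => [[s|t]|t] bx.
- exact/connect1/bottom_face_on_spine.
- exact/connect1/bottom_face_on_spine.
have [s [sx row]] := row_end_pillar x_int bx.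
apply: connect_trans (connect1 (row_attached_pillar (up' := ~~ up) _ row)) _.
  by rewrite sx.
exact/connect1/bottom_face_on_spine.
Qed.

Lemma pillar_unit_step x : (x <= L)%N ->
  exists b, xcoord b false = x /\ xcoord b true = x.+1.
Proof. by rewrite -ltnS => x_lt; exists (Column (inr (Ordinal x_lt))). Qed.

Lemma pillar_one_plane (f g : face #|{: block_label S L H}|) :
  (0 < xcoord (enum_val f.1) f.2 <= L)%N ->
  xcoord (enum_val f.1) f.2 = xcoord (enum_val g.1) g.2 ->
  plane F xdir f = plane F xdir g.
Proof.
move=> f_int fg; apply/eq_plane; rewrite -(tile_face_eta f) -(tile_face_eta g).
apply: connect_trans (connect_spine f_int erefl) _.
by rewrite attached_connect_sym; apply: connect_spine.
Qed.

End PillarPlanes.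

(* Two consecutive pillars of a row have the abscissae x and x'. *)
Definition row_gap (S : finType) (L H : nat) (A : layout S L H)
    (x x' : nat) : Prop :=
  exists s, [/\ px A s = x, run_end (transpose A) (inl s) = x' & (x' <= L)%N].

(* A row between two pillars is the only kind of block that is wider than one
   unit and touches neither of the two extreme planes. *)
Lemma isomorphic_row_gap (R : realType) (S : finType) (L H : nat)
    (A B : layout S L H) x x' :
  isomorphic (dissection_graph (pillar_floorplan R A) xdir)
    (dissection_graph (pillar_floorplan R B) xdir) ->
  row_gap A x x' -> (x.+2 < x')%N -> row_gap B x x'.
Proof.
pose coord (C : layout S L H) (f : face #|{: block_label S L H}|) :=
  tile_coord (pillar_tiling C) xdir (enum_val f.1) f.2.
move=> iso [s [<- <- end_le]] wide.
have unit_steps y : (y < L.+1)%N ->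
    exists i, coord A (i, false) = y /\ coord A (i, true) = y.+1.
  move=> /(pillar_unit_step A)[b [b_lo b_hi]]; exists (enum_rank b).
  by rewrite /coord /= enum_rankK.
have [psi psiE] := isomorphism_keeps_coords (cF := coord A) (cG := coord B)
  (grid_face_coord _ xdir) (fun f => tile_coord_le _ xdir _ f.2) unit_steps
  (@pillar_one_plane R _ _ _ A) iso.
have end_int : (0 < run_end (transpose A) (inl s) < L.+1)%N by lia.
have start_int : ((px A s).+1 < L.+1)%N := px_lt A s.
have := psiE (tile_face (Row (inl s)) false).
have := psiE (tile_face (Row (inl s)) true).
rewrite /coord /tile_coord /= enum_rankK /= /vec3 /= end_int start_int.
move=> /(_ isT) end_eq /(_ isT) start_eq; move: end_eq start_eq.
case: (enum_val (psi _)) => [[s'|t]|[s'|y]];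
  rewrite /= /vec3 /= => end_eq start_eq.
- by rewrite -end_eq start_eq ltnn in wide.
- by rewrite -end_eq start_eq ltnn in wide.
- by exists s'; split=> //; case: start_eq.
- by [].
Qed.

(** * Counting topological equivalence classes *)

Lemma finite_image_factor (X Y : Type) (C : finType) (A : set X) (code : X -> C)
    (f : X -> Y) :
  (forall x x', code x = code x' -> f x = f x') -> finite_set (f @` A).
Proof.
move=> f_code; have [->|/set0P[x0 _]] := eqVneq A set0;
  first by rewrite image_set0.
have /choice[g gE] c : exists y, forall x, code x = c -> f x = y.
  have [[x <-]|no_x] := pselect (exists x, code x = c).
    by exists (f x) => x' /f_code.
  by exists (f x0) => x xc; case: no_x; exists x.
apply: (@sub_finite_set _ _ (g @` setT)); last exact/finite_image/finite_finset.
by move=> _ [x _ <-]; exists (code x) => //; rewrite -(gE _ _ erefl).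
Qed.

Section FiniteClasses.
Context {R : realType} {n : nat}.
Implicit Types F G : floorplan R n.

Lemma face_classP (cl : face n -> {set face n}) f : [exists g, cl f == cl g].
Proof. by apply/existsP; exists f. Qed.

Definition face_class_graph (cl : face n -> {set face n}) : multidigraph :=
  @Multidigraph {P : {set face n} | [exists f, P == cl f]} 'I_n
    (fun i => exist _ (cl (i, false)) (face_classP cl (i, false)))
    (fun i => exist _ (cl (i, true)) (face_classP cl (i, true))).

Lemma dissection_graphE F d :
  dissection_graph F d = face_class_graph (plane_of F d).
Proof. by congr Multidigraph; apply/funext => i; apply: val_inj. Qed.

Lemma T_classes_finite : finite_set (@T_classes R n).
Proof.
pose code F := [ffun d => [ffun f => plane_of F d f]].
apply: (@finite_image_factor _ _ _ _ code) => F F' FF'.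
have graphE d : dissection_graph F d = dissection_graph F' d.
  rewrite !dissection_graphE; congr face_class_graph; apply/funext => f.
  by have /ffunP/(_ d) := FF'; rewrite !ffunE => /ffunP/(_ f); rewrite !ffunE.
by apply/seteqP; split=> G [? FG]; split=> // d; have := FG d; rewrite graphE.
Qed.

Lemma topologically_equivalent_refl F : topologically_equivalent F F.
Proof. by move=> d; exists id, id; split=> //; exists id. Qed.

Lemma card_T_ge (I : finType) (F : I -> floorplan R n) :
  (forall i, generic_two_layer (F i)) ->
  (forall i i', topologically_equivalent (F i) (F i') -> i = i') ->
  (#|I| <= card_T R n)%N.
Proof.
move=> F_generic F_inj; pose cl i := equivalence_class (F i).
have cl_inj : injective cl.
  move=> i i' E; apply: F_inj.
  have : cl i' (F i') by split=> //; exact: topologically_equivalent_refl.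
  by rewrite -E => -[].
rewrite cardE -(size_map cl); apply: uniq_leq_size.
  by rewrite (map_inj_uniq cl_inj) enum_uniq.
move=> _ /mapP[i _ ->]; rewrite in_fset_set; last exact: T_classes_finite.
by apply/mem_set; exists (F i).
Qed.

End FiniteClasses.

Lemma digits_inj B q q' r r' : (r < B)%N -> (r' < B)%N ->
  (q * B + r = q' * B + r')%N -> q = q' /\ r = r'.
Proof.
move=> rB r'B E; have := edivn_eq q rB.
by rewrite E (edivn_eq q' r'B) => -[-> ->].
Qed.

Lemma digits_lt B m q r : (q < m)%N -> (r < B)%N -> (q * B + r < m * B)%N.
Proof.
move=> qm rB; apply: (@leq_trans (q.+1 * B)); last by rewrite leq_mul2r qm orbT.
by rewrite mulSn addnC ltn_add2r.
Qed.

Definition twist_slope (m : nat) : nat :=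
  (3 * (m * m * m) + 7 * (m * m) + 2 * m)%N.

Section TwistedLayout.
Context (m P e : nat).

(* Group j of the pillars has one pillar in each of the m * m * P rows
   (i, k, a), and these pillars share m * P columns: those of the rows with the
   same i if j is even, or the same k if j is odd, are put in a common set of P
   columns. *)
Definition pillar_row := ('I_m * 'I_m * 'I_P)%type.
Definition site : finType := ('I_m.+1 * pillar_row)%type.
Definition twist : finType := {ffun 'I_m * ('I_m * 'I_m) -> {perm 'I_P}}.
Implicit Types (th : twist) (r : pillar_row) (j : nat) (s : site).

Definition twist_perm th j (ik : 'I_m * 'I_m) : {perm 'I_P} :=
  if j is j'.+1 then if insub j' is Some g then th (g, ik) else 1%g else 1%g.

Definition row_class j r : nat := if odd j then r.1.2 else r.1.1.

Definition column_offset th j r : nat :=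
  (row_class j r * P + twist_perm th j r.1 r.2)%N.

(* The gap of one column between two groups makes the rows between consecutive
   pillars wider than one unit. *)
Definition column th j r : nat := (j * (m * P).+1 + column_offset th j r)%N.

Definition row_index r : nat := ((r.1.1 * m + r.1.2) * P + r.2)%N.

Definition site_x th s : nat := (column th s.1 s.2).*2.+1.
Definition site_y s : nat := (row_index s.2).*2.+1.

Definition twisted_length : nat := ((m.+1 * (m * P).+1).*2 + e)%N.
Definition twisted_height : nat := (m * m * P).*2.

Lemma row_index_lt r : (row_index r < m * m * P)%N.
Proof. by rewrite !digits_lt. Qed.

Lemma row_index_inj : injective row_index.
Proof.
move=> [[i k] a] [[i' k'] a'] /digits_inj[] // /digits_inj[] // ii' kk' aa'.
by congr (_, _, _); apply: val_inj.
Qed.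

Lemma row_class_inj j r r' : row_class j r = row_class j r' ->
  row_class j.+1 r = row_class j.+1 r' -> r.1 = r'.1.
Proof.
case: r r' => [[i k] a] [[i' k'] a']; rewrite /row_class /=.
by case: (odd j) => /= /val_inj -> /val_inj ->.
Qed.

Lemma column_offset_lt th j r : (column_offset th j r < m * P)%N.
Proof. by rewrite digits_lt // /row_class; case: ifP. Qed.

Lemma column_inj th th' j j' r r' : column th j r = column th' j' r' ->
  [/\ j = j', row_class j r = row_class j r' &
      twist_perm th j r.1 r.2 = twist_perm th' j r'.1 r'.2].
Proof.
case/digits_inj; try exact/ltnW/column_offset_lt.
by move=> <- /digits_inj[] // -> /val_inj ->.
Qed.

Lemma column_gap th j j' r : (j < j')%N ->
  ((column th j r).+1 < column th j' r)%N.
Proof.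
move=> jj'; have := column_offset_lt th j r.
have : (j.+1 * (m * P).+1 <= j' * (m * P).+1)%N by rewrite leq_mul2r jj' orbT.
by rewrite /column mulSn; lia.
Qed.

Lemma ltn_column th r : {mono column th ^~ r : j j' / (j < j')%N}.
Proof. by apply/leqW_mono/leq_mono => j j' /(column_gap th r)/ltnW. Qed.

Lemma site_inj th s s' :
  site_x th s = site_x th s' -> site_y s = site_y s' -> s = s'.
Proof.
case: s s' => [j r] [j' r'] [/double_inj/column_inj[jj' _ _]].
by move=> [/double_inj/row_index_inj /= ->]; rewrite (val_inj jj').
Qed.

Lemma site_x_odd th s : odd (site_x th s).
Proof. by rewrite /= odd_double. Qed.

Lemma site_y_odd s : odd (site_y s).
Proof. by rewrite /= odd_double. Qed.

Lemma site_x_lt th s : (site_x th s < twisted_length)%N.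
Proof.
have : (column th s.1 s.2 < m.+1 * (m * P).+1)%N.
  by apply: digits_lt => //; exact/ltnW/column_offset_lt.
by rewrite /site_x /twisted_length; lia.
Qed.

Lemma site_y_lt s : (site_y s < twisted_height)%N.
Proof. by rewrite /site_y /twisted_height; have := row_index_lt s.2; lia. Qed.

Definition twisted_layout th : layout site twisted_length twisted_height :=
  Layout (@site_inj th) (site_x_odd th) site_y_odd (site_x_lt th) site_y_lt.

Lemma twisted_row_gap th j r (j_lt : (j < m)%N) :
  row_gap (twisted_layout th) (column th j r).*2.+1 (column th j.+1 r).*2.+1.
Proof.
pose s : site := (Ordinal (leqW j_lt), r).
pose s' : site := (Ordinal (j_lt : (j.+1 < m.+1)%N), r).
have gap := column_gap th r (ltnSn j); have x_lt := site_x_lt th s'.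
exists s; split=> //; last exact: ltnW.
apply: run_end_eq.
- apply/andP; split; last exact/leqW/ltnW/x_lt.
  suff : ((column th j r).*2 < (column th j.+1 r).*2)%N by [].
  by rewrite ltn_double ltnW.
- move=> x /andP[s_x x_s']; rewrite pillar_at_transpose.
  case E: pillar_at => [[j1 r1]|//]; move: ((pillar_atP _ _ _ _).1 E) s_x x_s'.
  case=> <- [/double_inj/row_index_inj ->] s_x x_s'.
  have j_lt_j1 : (j < j1)%N.
    by rewrite -(ltn_column th r) -ltn_double; exact: s_x.
  have : (j1 < j.+1)%N.
    by rewrite -(ltn_column th r) -ltn_double; exact: x_s'.
  by rewrite ltnS leqNgt j_lt_j1.
by rewrite pillar_at_transpose (pillar_at_site (twisted_layout th) s').
Qed.

Lemma row_gap_columns th x x' : row_gap (twisted_layout th) x x' ->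
  exists j j' r, x = (column th j r).*2.+1 /\ x' = (column th j' r).*2.+1.
Proof.
case=> -[j r] [<- x'E x'_le]; rewrite -x'E in x'_le *.
have := run_end_pillar x'_le; rewrite pillar_at_transpose.
case E: pillar_at => [[j' r']|//] _; have [<-] := (pillar_atP _ _ _ _).1 E.
by move=> [/double_inj/row_index_inj /= <-]; exists j, j', r'.
Qed.

Lemma twist_recovery th th' :
  (forall x x', row_gap (twisted_layout th) x x' -> (x.+2 < x')%N ->
    row_gap (twisted_layout th') x x') ->
  th = th'.
Proof.
move=> recover.
have permE j : (j <= m)%N -> twist_perm th j =1 twist_perm th' j.
  elim: j => // j IH j_lt ik; apply/permP => a; pose r : pillar_row := (ik, a).
  have gap := column_gap th r (ltnSn j).
  have := recover _ _ (twisted_row_gap th r j_lt).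
  case/(_ _)/row_gap_columns; first by lia.
  move=> j1 [j2 [r' [/succn_inj/double_inj/column_inj[_ class_j perm_j]]]].
  move=> /succn_inj/double_inj/column_inj[_ class_j1 perm_j1].
  have ikE := row_class_inj class_j class_j1; rewrite -ikE in perm_j perm_j1.
  move: perm_j; rewrite IH ?(ltnW j_lt) // => /perm_inj aE.
  by rewrite -aE in perm_j1.
apply/ffunP => -[g ik]; have := permE g.+1 (ltn_ord g) ik.
by rewrite /twist_perm valK.
Qed.

Lemma card_twisted_label :
  #|{: block_label site twisted_length twisted_height}| =
  (P * twist_slope m + (2 * m + 4) + e)%N.
Proof.
rewrite !card_sum !card_prod !card_ord.
by rewrite /twisted_length /twisted_height /twist_slope; lia.
Qed.

Lemma card_T_twisted (R : realType) :
  (P`! ^ (m * m * m) <=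
   card_T R #|{: block_label site twisted_length twisted_height}|)%N.
Proof.
have -> : (P`! ^ (m * m * m))%N = #|twist|.
  by rewrite card_ffun !card_prod !card_ord card_Sn mulnA.
pose F th := pillar_floorplan R (twisted_layout th).
apply: (card_T_ge (F := F)) => [th|th th' equiv].
  by split; [exact: pillar_floorplan_two_layer|exact: pillar_floorplan_generic].
by apply: twist_recovery => x x'; exact: isomorphic_row_gap (equiv xdir).
Qed.

End TwistedLayout.

(** * Asymptotics *)

Section Logarithms.
Context {R : realType}.
Implicit Types (n p : nat) (C d T : R).

Lemma ln_natr_ge0 n : 0 <= ln (n%:R : R).
Proof. by case: n => [|n]; [rewrite ln0|apply: ln_ge0; rewrite ler1n]. Qed.

Lemma ln_fact_ge p : p%:R * (ln (p%:R : R) - 1) <= ln (p`!%:R : R).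
Proof.
case: p => [|p]; first by rewrite mul0r fact0 ln1.
have p_gt0 : 0 < p.+1%:R :> R by rewrite ltr0n.
have fact_gt0 : 0 < p.+1`!%:R :> R by rewrite ltr0n fact_gt0.
have : p.+1%:R ^+ p.+1 <= expR p.+1%:R * p.+1`!%:R :> R.
  by rewrite -ler_pdivrMr // (le_trans _ (expR_ge1Dxn p (ltW p_gt0))) // lerDr.
rewrite -ler_ln ?posrE ?mulr_gt0 ?exprn_gt0 ?expR_gt0 // lnXn //.
rewrite lnM ?posrE ?expR_gt0 //.
by rewrite expRK -mulr_natl; lra.
Qed.

Lemma near_ln_natr_ge T : \forall n \near \oo, T <= ln (n%:R : R).
Proof.
near=> n; have T_n : expR T <= n%:R by near: n; exact: nbhs_infty_ger.
by rewrite -[T]expRK ler_ln ?posrE ?expR_gt0 // (lt_le_trans _ T_n) ?expR_gt0.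
Unshelve. all: by end_near. Qed.

Lemma near_lnM_le C d : 0 < C -> 0 < d ->
  \forall p \near \oo, ln (C * p%:R) <= (1 + d) * (ln p%:R - 1).
Proof.
move=> C_gt0 d_gt0; near=> p.
have p_gt0 : 0 < p%:R :> R by rewrite ltr0n; near: p; exact: nbhs_infty_gt.
have : (1 + d + ln C) / d <= ln p%:R by near: p; exact: near_ln_natr_ge.
by rewrite lnM // ler_pdivrMr //; lra.
Unshelve. all: by end_near. Qed.

Lemma cvg_divn_subn (c b : nat) : (0 < c)%N ->
  ((n - b) %/ c)%N @[n --> \oo] --> \oo.
Proof.
by move=> c_gt0; exact: (cvg_comp _ _ (cvg_subnr b) (cvg_divnr _ c_gt0)).
Qed.

Lemma near_le_divn (c b : nat) d : (0 < c)%N -> 0 < d ->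
  \forall n \near \oo, n%:R <= (1 + d) * c%:R * ((n - b) %/ c)%:R.
Proof.
move=> c_gt0 d_gt0.
have n_le n : n%:R <= c%:R * ((n - b) %/ c)%:R + (c + b)%:R :> R.
  by rewrite -natrM -natrD ler_nat; have := ltn_ceil (n - b) c_gt0; lia.
near=> n; have : (c + b)%:R / (d * c%:R) <= ((n - b) %/ c)%:R.
  by near: n; exact: (cvg_divn_subn b c_gt0 (nbhs_infty_ger _)).
by have := n_le n; rewrite ler_pdivrMr ?mulr_gt0 ?ltr0n //; lra.
Unshelve. all: by end_near. Qed.

Lemma near_mul_ln_le_divn (c b : nat) d : (0 < c)%N -> 0 < d ->
  \forall n \near \oo, let p := ((n - b) %/ c)%N in
    n%:R * ln n%:R <= (1 + d) ^+ 2 * c%:R * (p%:R * (ln p%:R - 1)).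
Proof.
move=> c_gt0 d_gt0; have C_gt0 : 0 < (1 + d) * c%:R.
  by rewrite mulr_gt0 ?addr_gt0 ?ltr0n.
near=> n => /=; set p := ((n - b) %/ c)%N.
have n_gt0 : 0 < n%:R :> R by rewrite ltr0n; near: n; exact: nbhs_infty_gt.
have n_le : n%:R <= (1 + d) * c%:R * p%:R.
  by rewrite /p; near: n; exact: near_le_divn.
have ln_le : ln n%:R <= (1 + d) * (ln p%:R - 1).
  apply: (@le_trans _ _ (ln ((1 + d) * c%:R * p%:R))).
    by rewrite ler_ln // posrE // (lt_le_trans n_gt0).
  rewrite /p; near: n.
  exact: (cvg_divn_subn b c_gt0 (near_lnM_le C_gt0 d_gt0)).
apply: le_trans (ler_pM (ltW n_gt0) (ln_natr_ge0 n) n_le ln_le) _.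
by rewrite le_eqVlt; apply/orP; left; apply/eqP; ring.
Unshelve. all: by end_near. Qed.

Lemma exists_vanishing_error (a : R) (f g : nat -> R) :
  (forall n, 0 <= f n) -> (forall n, 0 <= g n) ->
  (forall eps, 0 < eps -> \forall n \near \oo, (a - eps) * f n <= g n) ->
  exists e : nat -> R, e n @[n --> \oo] --> (0 : R) /\
    forall n, (a - e n) * f n <= g n.
Proof.
move=> f_ge0 g_ge0 asymp; exists (fun n => Num.max 0 ((a * f n - g n) / f n)).
split=> [|n].
  apply/cvgrPdist_le => eps eps_gt0; near=> n.
  rewrite sub0r normrN ger0_norm ?le_max ?lexx // ge_max (ltW eps_gt0) /=.
  have [->|fn_neq0] := eqVneq (f n) 0; first by rewrite invr0 mulr0 ltW.
  have fn_gt0 : 0 < f n by rewrite lt_def fn_neq0 f_ge0.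
  rewrite ler_pdivrMr // lerBlDr -lerBlDl -mulrBl.
  by near: n; exact: asymp.
have [->|fn_neq0] := eqVneq (f n) 0; first by rewrite mulr0.
have fn_gt0 : 0 < f n by rewrite lt_def fn_neq0 f_ge0.
by rewrite mulrBl lerBlDl -lerBlDr -ler_pdivrMr // le_max lexx orbT.
Unshelve. all: by end_near. Qed.

End Logarithms.

Section LowerBound.
Context {R : realType}.

Lemma ln_card_T_ge (m p n : nat) : (p * twist_slope m + (2 * m + 4) <= n)%N ->
  (m * m * m)%:R * (p%:R * (ln (p%:R : R) - 1)) <= ln ((card_T R n)%:R : R).
Proof.
move=> n_ge.
have := card_T_twisted m p (n - (p * twist_slope m + (2 * m + 4))) R.
rewrite card_twisted_label subnKC // -(ler_nat R) natrX => card_ge.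
have fact_gt0 : 0 < p`!%:R :> R by rewrite ltr0n fact_gt0.
apply: (@le_trans _ _ (ln (p`!%:R ^+ (m * m * m)))).
  by rewrite lnXn // -[leRHS]mulr_natl ler_wpM2l // ln_fact_ge.
by rewrite ler_ln ?posrE ?(lt_le_trans _ card_ge) ?exprn_gt0.
Qed.

(* As m grows, the slope is asymptotically 3 m ^ 3. *)
Lemma twist_slope_le (eps : R) : 0 < eps < 3^-1 -> exists (m : nat) (d : R),
  [/\ (0 < m)%N, 0 < d &
    (3^-1 - eps) * ((1 + d) ^+ 2 * (twist_slope m)%:R) <= (m * m * m)%:R].
Proof.
move=> /andP[eps_gt0 eps_lt]; near \oo => m.
have m_gt0 : 0 < m%:R :> R by rewrite ltr0n; near: m; exact: nbhs_infty_gt.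
have d_gt0 : 0 < m%:R^-1 :> R by rewrite invr_gt0.
have d_eps : 5 * m%:R^-1 <= eps.
  rewrite ler_pdivrMr // mulrC -ler_pdivrMr //.
  by near: m; exact: nbhs_infty_ger.
exists m, m%:R^-1; split=> //; first by rewrite -(ltr0n R).
set d := m%:R^-1 in d_gt0 d_eps *.
have -> : (twist_slope m)%:R = (m * m * m)%:R * (3 + 7 * d + 2 * d ^+ 2).
  by rewrite /twist_slope !natrD !natrM /d; field; rewrite gt_eqF.
rewrite [(1 + d) ^+ 2 * _]mulrCA [(3^-1 - eps) * _]mulrCA -[leRHS]mulr1.
rewrite ler_wpM2l //.
have d_sqr_le : d ^+ 2 <= d by rewrite expr2 ler_piMl //; lra.
have d_sqr_ge0 : 0 <= d ^+ 2 by exact: sqr_ge0.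
apply: (@le_trans _ _ ((3^-1 - 5 * d) * ((1 + 3 * d) * (3 + 9 * d))));
  last by nra.
apply: ler_pM; [lra|by rewrite mulr_ge0 ?sqr_ge0 //; lra|lra|].
by apply: ler_pM; rewrite ?sqr_ge0 //; lra.
Unshelve. all: by end_near. Qed.

Lemma near_ln_card_T_ge (eps : R) : 0 < eps ->
  \forall n \near \oo, (3^-1 - eps) * (n%:R * ln n%:R) <=
    ln ((card_T R n)%:R : R).
Proof.
move=> eps_gt0; have [eps_ge|eps_lt] := leP 3^-1 eps.
  apply: nearW => n; apply: le_trans (ln_natr_ge0 _).
  by rewrite mulr_le0_ge0 ?subr_le0 // mulr_ge0 // ln_natr_ge0.
have [|m [d [m_gt0 d_gt0 slope_le]]] := @twist_slope_le eps;
  first by rewrite eps_gt0.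
have slope_gt0 : (0 < twist_slope m)%N by rewrite /twist_slope; lia.
near=> n; have n_large : (2 * m + 4 <= n)%N by near: n; exact: nbhs_infty_ge.
have : let p := ((n - (2 * m + 4)) %/ twist_slope m)%N in
    n%:R * ln n%:R <= (1 + d) ^+ 2 * (twist_slope m)%:R *
      (p%:R * (ln p%:R - 1)).
  by near: n; exact: near_mul_ln_le_divn.
set p := (_ %/ _)%N => /= n_le.
have p_ge0 : 0 <= p%:R * (ln p%:R - 1) :> R.
  have slope_pos : 0 < (1 + d) ^+ 2 * (twist_slope m)%:R.
    by rewrite mulr_gt0 ?exprn_gt0 ?addr_gt0 ?ltr0n.
  rewrite -(pmulr_rge0 _ slope_pos) (le_trans _ n_le) //.
  by rewrite mulr_ge0 ?ln_natr_ge0.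
apply: (@le_trans _ _ ((m * m * m)%:R * (p%:R * (ln p%:R - 1)))); last first.
  have := leq_trunc_div (n - (2 * m + 4)) (twist_slope m) => p_le.
  by apply: ln_card_T_ge; lia.
apply: le_trans (ler_wpM2r p_ge0 slope_le).
by rewrite -mulrA ler_wpM2l // subr_ge0 ltW.
Unshelve. all: by end_near. Qed.

End LowerBound.

Theorem theorem2 (R : realType) :
  exists e : nat -> R,
    e n @[n --> \oo] --> (0 : R) /\
    forall n : nat, (0 < n)%N ->
      (3^-1 - e n) * n%:R * ln n%:R <= ln ((card_T R n)%:R : R).
Proof.
have [||e [e_cvg0 e_le]] :=
  exists_vanishing_error _ _ (@near_ln_card_T_ge R).
- by move=> n; rewrite mulr_ge0 // ln_natr_ge0.
- by move=> n; exact: ln_natr_ge0.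
by exists e; split=> // n _; rewrite -mulrA.
Qed.
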